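(* Assume the coefficient conditions (A) stated in the context hold for every $t=0,\dots,T-1$. The value function $V_t$ (defined recursively in the context) has the quadratic form $$V_t(x_t)=\tfrac12 x_t'P_tx_t+x_t'p_t+r_t ,$$ where $P_t\in\mathbb{R}^{d_x\times d_x}$, $p_t\in\mathbb{R}^{d_x}$, $r_t\in\mathbb{R}$ are deterministic and satisfy the following backward recursions, for $t=T-1,\dots,0$: (i) $$\begin{aligned}P_t=&-(\mathfrak{A}^{(1)}_{t+1})'(\mathfrak{B}^{(1)}_{t+1})^{-1}\mathfrak{A}^{(1)}_{t+1}-2(\mathfrak{A}^{(1)}_{t+1})'(\mathfrak{B}^{(1)}_{t+1})^{-1}\mathfrak{C}_{t+1}(\mathfrak{G}_{t+1})^{-1}\mathfrak{A}^{(2)}_{t+1}\\&+(\mathfrak{A}^{(1)}_{t+1})'(\mathfrak{B}^{(1)}_{t+1})^{-1}\mathfrak{C}_{t+1}(\mathfrak{G}_{t+1})^{-1}\mathfrak{C}_{t+1}'(\mathfrak{B}^{(1)}_{t+1})^{-1}\mathfrak{A}^{(1)}_{t+1}+(\mathfrak{A}^{(2)}_{t+1})'(\mathfrak{G}_{t+1})^{-1}\mathfrak{A}^{(2)}_{t+1}+2\left(\theta M+\tfrac12A'P_{t+1}A\right),\\ P_T=&\,M_T;\end{aligned}$$ (ii) $$\begin{aligned}p_t=&-(\mathfrak{A}^{(1)}_{t+1})'(\mathfrak{B}^{(1)}_{t+1})^{-1}\mathfrak{a}^{(1)}_{t+1}-(\mathfrak{A}^{(1)}_{t+1})'(\ma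thfrak{B}^{(1)}_{t+1})^{-1}\mathfrak{C}_{t+1}(\mathfrak{G}_{t+1})^{-1}\mathfrak{a}^{(2)}_{t+1}\\&+(\mathfrak{A}^{(1)}_{t+1})'(\mathfrak{B}^{(1)}_{t+1})^{-1}\mathfrak{C}_{t+1}(\mathfrak{G}_{t+1})^{-1}\mathfrak{C}_{t+1}'(\mathfrak{B}^{(1)}_{t+1})^{-1}\mathfrak{a}^{(1)}_{t+1}-(\mathfrak{A}^{(2)}_{t+1})'(\mathfrak{G}_{t+1})^{-1}\mathfrak{C}_{t+1}'(\mathfrak{B}^{(1)}_{t+1})^{-1}\mathfrak{a}^{(1)}_{t+1}\\&+(\mathfrak{A}^{(2)}_{t+1})'(\mathfrak{G}_{t+1})^{-1}\mathfrak{a}^{(2)}_{t+1}+A'P_{t+1}a+\theta m+A'p_{t+1},\\ p_T=&\,m_T;\end{aligned}$$ (iii) $$\begin{aligned}r_t=&-\tfrac12(\mathfrak{a}^{(1)}_{t+1})'(\mathfrak{B}^{(1)}_{t+1})^{-1}\mathfrak{a}^{(1)}_{t+1}-(\mathfrak{a}^{(1)}_{t+1})'(\mathfrak{B}^{(1)}_{t+1})^{-1}\mathfrak{C}_{t+1}(\mathfrak{G}_{t+1})^{-1}\mathfrak{a}^{(2)}_{t+1}\\&+\tfrac12(\mathfrak{a}^{(1)}_{t+1})'(\mathfrak{B}^{(1)}_{t+1})^{-1}\mathfrak{C}_{t+1}(\mathfrak{G}_{t+1})^{-1}\mathfrak{C}_{t+1}'(\mathfrak{B}^{(1)}_{t+1})^{-1}\mathfrak{a}^{(1)}_{t+1}+\tfrac12(\mathfrak{a}^{(2)}_{t+1})'(\mathfrak{G}_{t+1})^{-1}\mathfrak{a}^{(2)}_{t+1}\\&+\tfrac12\mathrm{tr}(B\Xi_tB'P_{t+1})+\tfrac12\mathrm{tr}(\Lambda_tP_{t+1})+r_{t+1}+\tfrac12a'P_{t+1}a+a'p_{t+1}+\theta\,\mathrm{tr}(\Xi_tN_t),\\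 r_T=&\,0.\end{aligned}$$ Furthermore, for each $t=0,\dots,T-1$ the candidate optimal controls are given by the stationary point $(u_t^*,\gamma_t^*,\eta_t^* )$ of the function $F$ defined in the context, according to the formulas $$u_t^*=-(\mathfrak{B}^{(1)}_{t+1})^{-1}\left[\mathfrak{A}^{(1)}_{t+1}x_t+\mathfrak{a}^{(1)}_{t+1}+\mathfrak{C}_{t+1}\gamma_t^*\right]-\eta_t^*,\quad \gamma_t^*=-(\mathfrak{B}^{(2)}_{t+1})^{-1}\left[\mathfrak{A}^{(2)}_{t+1}x_t+\mathfrak{a}^{(2)}_{t+1}+\mathfrak{C}_{t+1}'(u_t^*+\eta_t^* )\right],\quad \eta_t^*=0.$$
   Context: A prime denotes transpose; $>0$ for a matrix means positive definite. Fix an integer $T\ge1$, dimensions $d_x,d_u\in\mathbb{N}$ and $\theta\in(-1,0)\cup(0,\infty)$. Data: $a,m,m_T\in\mathbb{R}^{d_x}$, $n\in\mathbb{R}^{d_u}$, $A\in\mathbb{R}^{d_x\times d_x}$, $B\in\mathbb{R}^{d_x\times d_u}$, $Q\in\mathbb{R}^{d_u\times d_x}$; $M\in\mathbb{R}^{d_x\times d_x}$ symmetric positive semidefinite; $M_T\in\mathbb{R}^{d_x\times d_x}$ symmetric; and for $t=0,\dots,T-1$, $N_t\in\mathbb{R}^{d_u\times d_u}$ symmetric positive semidefinite, and positive definite covariance matrices $\Lambda_t\in\mathbb{R}^{d_x\times d_x}$, $\Xi_t\in\mathbb{R}^{d_u\times d_u}$. The matrices $P_t$ are taken to be symmetric.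 Controlled dynamics: given $x_t\in\mathbb{R}^{d_x}$ at time $t$ and a control triple $(\bar u,\bar\gamma,\bar\eta)\in\mathbb{R}^{d_u}\times\mathbb{R}^{d_x}\times\mathbb{R}^{d_u}$, $$x_{t+1}=a+Ax_t+B(\bar u+v)+w,\qquad w\sim\mathcal{N}(\bar\gamma,\Lambda_t),\quad v\sim\mathcal{N}(\bar\eta,\Xi_t)\text{ independent};$$ $\mathbf{E}^{\bar\gamma,\bar\eta}_{t,x_t}$ denotes the corresponding expectation. The value function is defined by the dynamic programming recursion $V_T(x)=\theta[x'M_Tx+x'm_T]$ and, for $t=T-1,\dots,0$, $$\begin{aligned}V_t(x_t)=\inf_{\bar u\in\mathbb{R}^{d_u}}\ \sup_{\bar\gamma\in\mathbb{R}^{d_x},\,\bar\eta\in\mathbb{R}^{d_u}}\Big\{&\theta\big[x_t'Mx_t+\mathrm{tr}(\Xi_tN_t)+(\bar u+\bar\eta)'N_t(\bar u+\bar\eta)+(\bar u+\bar\eta)'Qx_t+x_t'm+(\bar u+\bar\eta)'n\big]\\&-\tfrac12\big(\bar\gamma'\Lambda_t^{-1}\bar\gamma+\bar\eta'\Xi_t^{-1}\bar\eta\big)+\mathbf{E}^{\bar\gamma,\bar\eta}_{t,x_t}[V_{t+1}(x_{t+1})]\Big\}.\end{aligned}$$ Shorthand, for $t=0,\dots,T-1$: $\mathfrak{A}^{(1)}_{t+1}=B'P_{t+1}A+\theta Q$, $\mathfrak{A}^{(2)}_{t+1}=P_{t+1}'A$, $\mathfrak{a}^{(1)}_{t+1}=B'P_{t+1}a+B'p_{t+1}+\theta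 n$, $\mathfrak{a}^{(2)}_{t+1}=P_{t+1}'a+p_{t+1}$, $\mathfrak{B}^{(1)}_{t+1}=B'P_{t+1}B+2\theta N_t$, $\mathfrak{B}^{(2)}_{t+1}=-\Lambda_t^{-1}+P_{t+1}$, $\mathfrak{B}^{(3)}_{t+1}=-\Xi_t^{-1}+\mathfrak{B}^{(1)}_{t+1}$, $\mathfrak{C}_{t+1}=B'P_{t+1}$, $\mathfrak{G}_{t+1}=\mathfrak{C}_{t+1}'(\mathfrak{B}^{(1)}_{t+1})^{-1}\mathfrak{C}_{t+1}-\mathfrak{B}^{(2)}_{t+1}$. Conditions (A), for $t=0,\dots,T-1$: $$\mathfrak{B}^{(1)}_{t+1}>0\quad\text{and}\quad-\begin{pmatrix}\mathfrak{B}^{(2)}_{t+1}&\mathfrak{C}_{t+1}'\\\mathfrak{C}_{t+1}&\mathfrak{B}^{(3)}_{t+1}\end{pmatrix}>0.$$ For given $t$ and $x_t$, the function $F$ of $(\bar u,\bar\gamma,\bar\eta)\in\mathbb{R}^{d_u}\times\mathbb{R}^{d_x}\times\mathbb{R}^{d_u}$ is $$\begin{aligned}F(\bar u,\bar\gamma,\bar\eta)=&\tfrac12\bar u'\mathfrak{B}^{(1)}_{t+1}\bar u+\bar u'(\mathfrak{A}^{(1)}_{t+1}x_t+\mathfrak{a}^{(1)}_{t+1})+\tfrac12\bar\gamma'\mathfrak{B}^{(2)}_{t+1}\bar\gamma+\bar\gamma'(\mathfrak{A}^{(2)}_{t+1}x_t+\mathfrak{a}^{(2)}_{t+1})\\&+\tfrac12\bar\eta'\mathfrak{B}^{(3)}_{t+1}\bar\eta+\bar\eta'(\mathfrak{A}^{(1)}_{t+1}x_t+\mathfrak{a}^{(1)}_{t+1})+\bar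 u'\mathfrak{C}_{t+1}\bar\gamma+\bar u'\mathfrak{B}^{(1)}_{t+1}\bar\eta+\bar\eta'\mathfrak{C}_{t+1}\bar\gamma.\end{aligned}$$
   Formalization: Terminal values are P_T = 2θM_T and p_T = θm_T, as V_T(x) = θ[x'M_T x + x'm_T] forces, instead of M_T and m_T; and P_t is the symmetric part of the right-hand side of (i), which is not symmetric in general although P_t is taken symmetric. *)

(* Defs.v *)
From HB Require Import structures.
From mathcomp Require Export all_boot all_order all_algebra.
From mathcomp Require Export all_classical all_reals all_analysis.
Export numFieldNormedType.Exports.

Set Implicit Arguments.
Unset Strict Implicit.
Unset Printing Implicit Defensive.

Import Order.TTheory GRing.Theory Num.Theory.

Local Open Scope classical_set_scope.
Local Open Scope ring_scope.

Section LinearAlgebra.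
Context {R : realType}.

(* The scalar x'y; x'Sy is written dotc x (S *m y). *)
Definition dotc {d : nat} (x y : 'cV[R]_d) : R := (x^T *m y) 0 0.

Definition posdef {d : nat} (S : 'M[R]_d) : Prop :=
  S^T = S /\ forall x : 'cV[R]_d, x != 0 -> 0 < dotc x (S *m x).

Definition possemidef {d : nat} (S : 'M[R]_d) : Prop :=
  S^T = S /\ forall x : 'cV[R]_d, 0 <= dotc x (S *m x).

Definition sympart {d : nat} (S : 'M[R]_d) : 'M[R]_d := 2^-1 *: (S + S^T).

End LinearAlgebra.

Section Stationarity.
Context {R : realType} {V : normedModType R}.

Definition stationary (f : V -> R^o) (z : V) : Prop :=
  differentiable f z /\ forall h : V, 'd f z h = 0.

End Stationarity.

Section GaussianVectors.
Context {R : realType} {disp : measure_display} {Om : measurableType disp}.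

(* X ~ N(mu, S) for positive definite S: every nontrivial linear combination
   c'X is a univariate normal variable of mean c'mu and variance c'Sc.  The
   second argument of normal_prob is a standard deviation. *)
Definition gaussian_vector {d : nat} (P : probability Om R)
    (X : Om -> 'cV[R]_d) (mu : 'cV[R]_d) (S : 'M[R]_d) : Prop :=
  (forall i : 'I_d, measurable_fun [set: Om] (fun om => X om i 0 : R)) /\
  (forall c : 'cV[R]_d, c != 0 -> forall E : set R, measurable E ->
     P ((fun om => dotc c (X om)) @^-1` E) =
     normal_prob (dotc c mu) (Num.sqrt (dotc c (S *m c))) E).

(* The Borel sigma-algebra of R^d, generated by the coordinates. *)
Definition borel_cV {d : nat} : set_system 'cV[R]_d :=
  g_sigma_preimage (fun (i : 'I_d) (x : 'cV[R]_d) => x i 0 : R).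

Definition independent_vectors {d e : nat} (P : probability Om R)
    (X : Om -> 'cV[R]_d) (Y : Om -> 'cV[R]_e) : Prop :=
  forall E E', borel_cV E -> borel_cV E' ->
    P (X @^-1` E `&` Y @^-1` E') = (P (X @^-1` E) * P (Y @^-1` E'))%E.

End GaussianVectors.

(* backward T sT step is the sequence s_0, .., s_T with s_T = sT and
   s_t = step t s_(t+1) for t < T (see backwardT and backwardE). *)
Definition backward {S : Type} (T : nat) (sT : S) (step : nat -> S -> S)
    (t : nat) : S :=
  foldr step sT (iota t (T - t)).

Lemma backwardT (S : Type) (T : nat) (sT : S) (step : nat -> S -> S) :
  backward T sT step T = sT.
Proof. by rewrite /backward subnn. Qed.

Lemma backwardE (S : Type) (T : nat) (sT : S) (step : nat -> S -> S) (t : nat) :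
  (t < T)%N -> backward T sT step t = step t (backward T sT step t.+1).
Proof.
move=> ltT; rewrite /backward subnS.
by case: (T - t)%N (subn_gt0 t T) => [|k]; rewrite ltT.
Qed.

Record lq_data (R : realType) (dx du : nat) := LQData {
  theta : R;
  lq_a : 'cV[R]_dx;
  lq_m : 'cV[R]_dx;
  lq_mT : 'cV[R]_dx;
  lq_n : 'cV[R]_du;
  lq_A : 'M[R]_dx;
  lq_B : 'M[R]_(dx, du);
  lq_Q : 'M[R]_(du, dx);
  lq_M : 'M[R]_dx;
  lq_MT : 'M[R]_dx;
  lq_N : nat -> 'M[R]_du;
  lq_Lam : nat -> 'M[R]_dx;
  lq_Xi : nat -> 'M[R]_du }.

Section Problem.
Context {R : realType} {dx du : nat} (D : lq_data R dx du).

Local Notation th := (theta D).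
Local Notation a := (lq_a D).
Local Notation m := (lq_m D).
Local Notation mT := (lq_mT D).
Local Notation n := (lq_n D).
Local Notation A := (lq_A D).
Local Notation B := (lq_B D).
Local Notation Q := (lq_Q D).
Local Notation M := (lq_M D).
Local Notation MT := (lq_MT D).
Local Notation N := (lq_N D).
Local Notation Lam := (lq_Lam D).
Local Notation Xi := (lq_Xi D).

Definition next_state (x : 'cV[R]_dx) (u : 'cV[R]_du)
    (w : 'cV[R]_dx) (v : 'cV[R]_du) : 'cV[R]_dx :=
  a + A *m x + B *m (u + v) + w.

Section ValueFunction.
Context {disp : measure_display} {Om : measurableType disp}.
(* Pr t g e is the measure behind the expectation E_{t,x}^{g,e}; the noises
   of stage t are the random vectors w t and v t, on a common sample space. *)
Variables (Pr : nat -> 'cV[R]_dx -> 'cV[R]_du -> probability Om R)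
  (w : nat -> Om -> 'cV[R]_dx) (v : nat -> Om -> 'cV[R]_du).

Definition gaussian_noise (T : nat) : Prop :=
  forall t, (t < T)%N -> forall (g : 'cV[R]_dx) (e : 'cV[R]_du),
    [/\ gaussian_vector (Pr t g e) (w t) g (Lam t),
        gaussian_vector (Pr t g e) (v t) e (Xi t)
      & independent_vectors (Pr t g e) (w t) (v t)].

Definition running_cost (t : nat) (x : 'cV[R]_dx)
    (u : 'cV[R]_du) (g : 'cV[R]_dx) (e : 'cV[R]_du) : R :=
  th * (dotc x (M *m x) + \tr (Xi t *m N t) + dotc (u + e) (N t *m (u + e))
        + dotc (u + e) (Q *m x) + dotc x m + dotc (u + e) n)
  - 2^-1 * (dotc g (invmx (Lam t) *m g) + dotc e (invmx (Xi t) *m e)).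

Definition bellman (t : nat) (W : 'cV[R]_dx -> \bar R) (x : 'cV[R]_dx)
    : \bar R :=
  ereal_inf (range (fun u : 'cV[R]_du =>
    ereal_sup (range (fun ge : 'cV[R]_dx * 'cV[R]_du =>
      ((running_cost t x u ge.1 ge.2)%:E
       + \int[Pr t ge.1 ge.2]_om W (next_state x u (w t om) (v t om)))%E)))).

Definition terminal_value (x : 'cV[R]_dx) : \bar R :=
  (th * (dotc x (MT *m x) + dotc x mT))%:E.

Definition value (T t : nat) : 'cV[R]_dx -> \bar R :=
  backward T terminal_value bellman t.

End ValueFunction.

(* In this section P and p stand for P_(t+1) and p_(t+1). *)
Section Coefficients.
Variables (t : nat) (P : 'M[R]_dx) (p : 'cV[R]_dx).

Definition frakA1 : 'M[R]_(du, dx) := B^T *m P *m A + th *: Q.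
Definition frakA2 : 'M[R]_dx := P^T *m A.
Definition fraka1 : 'cV[R]_du := B^T *m P *m a + B^T *m p + th *: n.
Definition fraka2 : 'cV[R]_dx := P^T *m a + p.
Definition frakB1 : 'M[R]_du := B^T *m P *m B + (2 * th) *: N t.
Definition frakB2 : 'M[R]_dx := - invmx (Lam t) + P.
Definition frakB3 : 'M[R]_du := - invmx (Xi t) + frakB1.
Definition frakC : 'M[R]_(du, dx) := B^T *m P.
Definition frakG : 'M[R]_dx := frakC^T *m invmx frakB1 *m frakC - frakB2.

Definition conditionA : Prop :=
  posdef frakB1 /\ posdef (- block_mx frakB2 frakC^T frakC frakB3).

Definition recP : 'M[R]_dx :=
  - (frakA1^T *m invmx frakB1 *m frakA1)
  - 2 *: (frakA1^T *m invmx frakB1 *m frakC *m invmx frakG *m frakA2)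
  + frakA1^T *m invmx frakB1 *m frakC *m invmx frakG *m frakC^T
      *m invmx frakB1 *m frakA1
  + frakA2^T *m invmx frakG *m frakA2
  + 2 *: (th *: M + 2^-1 *: (A^T *m P *m A)).

Definition recp : 'cV[R]_dx :=
  - (frakA1^T *m invmx frakB1 *m fraka1)
  - frakA1^T *m invmx frakB1 *m frakC *m invmx frakG *m fraka2
  + frakA1^T *m invmx frakB1 *m frakC *m invmx frakG *m frakC^T
      *m invmx frakB1 *m fraka1
  - frakA2^T *m invmx frakG *m frakC^T *m invmx frakB1 *m fraka1
  + frakA2^T *m invmx frakG *m fraka2
  + A^T *m P *m a + th *: m + A^T *m p.

Definition recr (r : R) : R :=
  - (2^-1 * dotc fraka1 (invmx frakB1 *m fraka1))
  - dotc fraka1 (invmx frakB1 *m frakC *m invmx frakG *m fraka2)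
  + 2^-1 * dotc fraka1 (invmx frakB1 *m frakC *m invmx frakG *m frakC^T
                          *m invmx frakB1 *m fraka1)
  + 2^-1 * dotc fraka2 (invmx frakG *m fraka2)
  + 2^-1 * \tr (B *m Xi t *m B^T *m P) + 2^-1 * \tr (Lam t *m P)
  + r + 2^-1 * dotc a (P *m a) + dotc a p + th * \tr (Xi t *m N t).

Definition stage_F (x : 'cV[R]_dx) (z : 'cV[R]_du * 'cV[R]_dx * 'cV[R]_du) : R :=
  let: (u, g, e) := z in
  2^-1 * dotc u (frakB1 *m u) + dotc u (frakA1 *m x + fraka1)
  + 2^-1 * dotc g (frakB2 *m g) + dotc g (frakA2 *m x + fraka2)
  + 2^-1 * dotc e (frakB3 *m e) + dotc e (frakA1 *m x + fraka1)
  + dotc u (frakC *m g) + dotc u (frakB1 *m e) + dotc e (frakC *m g).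

End Coefficients.

(* The triples (P_t, p_t, r_t).  The quadratic form x'P_t x only determines the
   symmetric part of its matrix, and recP is not symmetric in general (its
   second term is not), whereas P_t is: hence sympart.  The terminal values are
   those that represent terminal_value, whose matrix is not halved and which
   carries the factor theta. *)
Definition coefs (T : nat) : nat -> 'M[R]_dx * 'cV[R]_dx * R :=
  backward T (2 * th *: MT, th *: mT, 0)
    (fun t c => let: (P, p, r) := c in
      (sympart (recP t P), recp t P p, recr t P p r)).

Definition coefP (T t : nat) : 'M[R]_dx := (coefs T t).1.1.
Definition coefp (T t : nat) : 'cV[R]_dx := (coefs T t).1.2.
Definition coefr (T t : nat) : R := (coefs T t).2.

End Problem.

(* Main.v *)
Require Import Defs.
From HB Require Import structures.
From mathcomp Require Import ring lra measurable_realfun.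

(* Backward induction on the stage.  If V_(t+1) is the quadratic function with
   coefficients (P, p, r), then the moments E X = mu and E XX' = mu mu' + S of
   Gaussian vectors turn the Bellman objective at x into F + const, where F is
   a quadratic function of (u, g, e).  Conditions (A) say that F is convex in u
   and concave in (g, e), so its critical point is a saddle point and inf sup F
   is the critical value.  At the critical point e = 0, because subtracting the
   u- and e-equations leaves Xi^-1 e = 0; eliminating u leaves G g = b2 - C' B1^-1 b1.

   The first two moments of N(m, s^2) are read off the exponential moments
   E exp(l (X - m)) = exp(l^2 s^2 / 2), which follow from translating the
   density: elementary inequalities squeeze E (X - m) and E (X - m)^2 between
   combinations of exponential moments, with an error vanishing as l -> 0. *)

Set Implicit Arguments.
Unset Strict Implicit.
Unset Printing Implicit Defensive.

Import Order.TTheory GRing.Theory Num.Theory.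

Local Open Scope classical_set_scope.
Local Open Scope ring_scope.

(** * Elementary inequalities for the exponential *)

Section ExponentialInequalities.
Context {R : realType}.
Implicit Types x y h : R.

(** Two uses of the mean value theorem give [f x = f2 d * (c * x)] with [c] between 0 and [x], and
    [c * x] is nonnegative on either side of 0. *)
Lemma convex_critical_ge0 (f f1 f2 : R -> R) :
    (forall x, is_derive x 1 f (f1 x)) -> (forall x, is_derive x 1 f1 (f2 x)) ->
    (forall x, 0 <= f2 x) -> f 0 = 0 -> f1 0 = 0 ->
  forall x, 0 <= f x.
Proof.
move=> df df1 f2_ge0 f0 f10 x.
have mvt (g g1 : R -> R) (dg : forall z : R, is_derive z 1 g (g1 z)) a b : a <= b ->
    exists2 c, a <= c <= b & g b - g a = g1 c * (b - a).
  move=> ab; have [//|c cab ->] := MVT_segment ab (fun z _ => dg z).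
    apply: derivable_within_continuous => z _; exact: (@ex_derive _ _ _ _ _ _ _ (dg z)).
  by exists c.
have [x0|/ltW x0] := leP 0 x.
  have [c /andP[c0 cx]] := mvt _ _ df _ _ x0.
  have [d _] := mvt _ _ df1 _ _ c0.
  rewrite f0 f10 !subr0 => -> ->; by rewrite !mulr_ge0.
have [c /andP[xc c0] fx] := mvt _ _ df _ _ x0.
have [d _ f1c] := mvt _ _ df1 _ _ c0.
have -> : f x = f2 d * (c * x).
  have ec : f1 c = f2 d * c by lra.
  by move: fx; rewrite ec; lra.
by rewrite mulr_ge0// mulr_le0.
Qed.

(** The second derivative of the difference is nonnegative by adding [1 + y <= expR y] at [y] and
    [- y]. This bounds a second moment above by exponential moments, and also supplies integrable
    dominants. *)
Lemma expRD_expRN_ge x : 2 + x ^+ 2 <= expR x + expR (- x).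
Proof.
rewrite -subr_ge0.
pose f y := expR y + expR (- y) - (2 + y ^+ 2).
rewrite -/(f x).
apply: (@convex_critical_ge0 f (fun y => expR y - expR (- y) - 2 * y)
         (fun y => expR y + expR (- y) - 2)).
- move=> y; rewrite /f; apply: is_derive_eq; rewrite /GRing.scale/=; ring.
- move=> y; apply: is_derive_eq; rewrite /GRing.scale/=; ring.
- move=> y; have := expR_ge1Dx y; have := expR_ge1Dx (- y); lra.
- rewrite /f oppr0 expR0; ring.
- rewrite oppr0 expR0; ring.
Qed.

(* The coefficients cancel the fourth-order terms, so that the second
   derivative of the difference is a square. *)
Lemma expRD_expRN_le x :
  (expR x + expR (- x) - 2) * (14 - expR x - expR (- x)) <= 12 * x ^+ 2.
Proof.
have EN y : expR y * expR (- y) = 1 by rewrite -expRD subrr expR0.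
rewrite -subr_ge0.
pose f y : R := 12 * y ^+ 2 - (expR y + expR (- y) - 2) * (14 - expR y - expR (- y)).
rewrite -/(f x).
apply: (@convex_critical_ge0 f
  (fun y => 24 * y - (expR y - expR (- y)) * (16 - 2 * (expR y + expR (- y))))
  (fun y => 4 * (expR y + expR (- y) - 2) ^+ 2)).
- move=> y; rewrite /f; apply: is_derive_eq; rewrite /GRing.scale/=; ring.
- move=> y; apply: is_derive_eq; rewrite /GRing.scale/=; ring: (EN y).
- by move=> y; rewrite mulr_ge0// sqr_ge0.
- rewrite /f oppr0 expR0; ring.
- rewrite oppr0 expR0; ring.
Qed.

(** From [1 - h <= expR (- h)] one gets [(1 - h) * expR h <= 1], while [(1 - h) * (1 + h + 2 * h ^+
    2) = 1 + h ^+ 2 * (1 - 2 * h)] is at least 1 for [h <= 1 / 2]. *)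
Lemma expR_le_quadratic h : 0 <= h <= 1 / 2 -> expR h <= 1 + h + 2 * h ^+ 2.
Proof.
move=> /andP[h0 h1]; have E1 : expR h * expR (- h) = 1.
  by rewrite -expRD subrr expR0.
have := expR_ge1Dx (- h); have := expR_gt0 h; nra.
Qed.

(** This is the passage to the limit [l -> 0], stated without limits; the guard on [c * l ^+ 2]
    describes the range where the exponential estimates are available. *)
Lemma le_of_small_error (a b c k : R) : 0 <= c ->
  (forall l, 0 < l <= 1 -> c * l ^+ 2 <= 1 / 8 -> a <= b + k * l) -> a <= b.
Proof.
move=> c0 H; apply/ler_addgt0Pr => e e0.
have c8 : 0 < (8 * (1 + c))^-1 by rewrite invr_gt0; lra.
have k1 : 0 < `|k| + 1 by rewrite ltr_wpDl.
(* The first bound makes both [l] and [c * l] at most 1/8; the second makes the error [k * l] at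
   most [e]. *)
pose l := Num.min (8 * (1 + c))^-1 (e / (`|k| + 1)).
have l0 : 0 < l by rewrite lt_min c8 divr_gt0.
have lc : l * (8 * (1 + c)) <= 1.
  by rewrite -ler_pdivlMr ?mul1r ?ge_min ?lexx//; lra.
have lk : l * (`|k| + 1) <= e by rewrite -ler_pdivlMr// ge_min lexx orbT.
apply: le_trans (H l _ _) _; [by apply/andP; split => //; nra|by nra|].
by have := ler_norm k; nra.
Qed.

End ExponentialInequalities.

(** * Calculus of expectations *)

Section Means.
Context {R : realType} {d : measure_display} {Om : measurableType d}.
Variable P : probability Om R.
Implicit Types (X Y : Om -> R) (m k : R).

(** Bundling integrability with the value lets moments of polynomials be assembled by sums and
    scalings, with no separate integrability goals. *)
Definition has_mean X m : Prop :=
  P.-integrable [set: Om] (EFin \o X) /\ (\int[P]_o (X o)%:E = m%:E)%E.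

Lemma eq_has_mean X Y m : X =1 Y -> has_mean X m -> has_mean Y m.
Proof. by move=> /funext ->. Qed.

Lemma has_mean_cst k : has_mean (fun=> k) k.
Proof.
split; first exact: finite_measure_integrable_cst.
by rewrite integral_cst//= probability_setT mule1.
Qed.

Lemma has_meanD X Y m k : has_mean X m -> has_mean Y k ->
  has_mean (fun o => X o + Y o) (m + k).
Proof.
move=> [iX eX] [iY eY]; split.
  by have := integrableD measurableT iX iY; apply: eq_integrable.
by rewrite integralD_EFin// eX eY.
Qed.

Lemma has_meanZ X m k : has_mean X m -> has_mean (fun o => k * X o) (k * m).
Proof.
move=> [iX eX]; split.
  by have := integrableZl measurableT k iX; apply: eq_integrable.
under eq_integral do rewrite EFinM.
by rewrite integralZl// eX.
Qed.

Lemma has_mean_sum (I : Type) (s : seq I) (X : I -> Om -> R) (m : I -> R) :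
  (forall i, has_mean (X i) (m i)) ->
  has_mean (fun o => \sum_(i <- s) X i o) (\sum_(i <- s) m i).
Proof.
move=> Xm; elim: s => [|i s IH].
  by rewrite big_nil; apply: eq_has_mean (has_mean_cst 0) => o; rewrite big_nil.
rewrite big_cons; apply: eq_has_mean (has_meanD (Xm i) IH) => o.
by rewrite big_cons.
Qed.

Lemma has_mean_le X Y m k : has_mean X m -> has_mean Y k ->
  (forall o, X o <= Y o) -> m <= k.
Proof.
move=> [iX eX] [iY eY] XY; rewrite -lee_fin -eX -eY.
by apply: le_integral => // o _; rewrite lee_fin.
Qed.

(** Domination yields existence only; the value of the mean is then identified by other means, such
    as squeezing or Fubini. *)
Lemma has_mean_dominated X Y k : measurable_fun [set: Om] X -> has_mean Y k ->
  (forall o, `|X o| <= Y o) -> exists m, has_mean X m.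
Proof.
move=> mX [iY _] XY.
have iX : P.-integrable [set: Om] (EFin \o X).
  apply: le_integrable iY => //; first exact/measurable_EFinP.
  move=> o _ /=; rewrite lee_fin; exact: le_trans (XY o) (ler_norm _).
exists (fine (\int[P]_o (X o)%:E)%E).
rewrite /has_mean; split; first exact: iX.
by rewrite fineK//; exact: integrable_fin_num.
Qed.

End Means.

(** * First two moments from exponential moments *)

Section MomentsFromExponentials.
Context {R : realType} {d : measure_display} {Om : measurableType d}.
Variables (P : probability Om R) (Z : Om -> R) (s : R).
Hypotheses (mZ : measurable_fun [set: Om] Z)
  (expZ : forall l, has_mean P (fun o => expR (l * Z o))
                               (expR (l ^+ 2 * s ^+ 2 / 2))).

Let cosh_mean l : has_mean P (fun o => expR (l * Z o) + expR (- (l * Z o)))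
  (2 * expR (l ^+ 2 * s ^+ 2 / 2)).
Proof.
have := has_meanD (expZ l) (expZ (- l)); rewrite sqrrN mulr2n mulrDl !mul1r.
by apply: eq_has_mean => o; rewrite mulNr.
Qed.

Let abs_bound l o : `|l * Z o| <= expR (l * Z o) + expR (- (l * Z o)).
Proof.
have := expRD_expRN_ge (l * Z o); have := sqr_ge0 (l * Z o - 1).
have := sqr_ge0 (l * Z o + 1).
by move=> ? ? ?; rewrite ler_norml; apply/andP; split; nra.
Qed.

Let c := s ^+ 2 / 2.

Let c_ge0 : 0 <= c. Proof. by rewrite mulr_ge0// sqr_ge0. Qed.

Let exp_bound l : c * l ^+ 2 <= 1 / 2 ->
  expR (l ^+ 2 * s ^+ 2 / 2) <= 1 + c * l ^+ 2 + 2 * (c * l ^+ 2) ^+ 2.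
Proof.
move=> cl; have -> : l ^+ 2 * s ^+ 2 / 2 = c * l ^+ 2 by rewrite /c; ring.
apply: expR_le_quadratic; rewrite mulr_ge0 ?sqr_ge0//=; lra.
Qed.

(** Taking means in [1 + l * Z <= expR (l * Z)] gives [l * m <= expR (c * l ^+ 2) - 1 <= 2 * c * l
    ^+ 2]. Dividing by small [l] of either sign squeezes [m] to 0. *)
Lemma centered_mean : has_mean P Z 0.
Proof.
have [m Zm] : exists m, has_mean P Z m.
  apply: has_mean_dominated mZ (cosh_mean 1) _ => o.
  by have := abs_bound 1 o; rewrite mul1r.
have bound l : c * l ^+ 2 <= 1 / 8 -> l * m <= 2 * c * l ^+ 2.
  move=> cl; have : 1 + l * m <= expR (l ^+ 2 * s ^+ 2 / 2).
    apply: has_mean_le (has_meanD (has_mean_cst P 1) (has_meanZ l Zm)) (expZ l) _.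
    by move=> o; exact: expR_ge1Dx.
  have cl2 : c * l ^+ 2 <= 1 / 2 by lra.
  move=> /le_trans/(_ (exp_bound cl2)).
  have : 0 <= c * l ^+ 2 by rewrite mulr_ge0 ?sqr_ge0.
  move: (c * l ^+ 2) cl (l * m) (mulrA 2 c (l ^+ 2)) => h h8 lm <-; nra.
suff -> : 0 = m by [].
apply/eqP; rewrite eq_le; apply/andP; split.
  apply: (le_of_small_error (k := 2 * c) c_ge0) => l /andP[l0 l1] cl.
  have := bound (- l); rewrite sqrrN => /(_ cl); nra.
apply: (le_of_small_error (k := 2 * c) c_ge0) => l /andP[l0 l1] cl.
have := bound l cl; nra.
Qed.

(** The upper bound on the moment integrates [expRD_expRN_ge] at [l * Z], the lower bound integrates
    [expRD_expRN_le]; after division by [l ^+ 2] both errors vanish with [l]. *)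
Lemma centered_second_moment : has_mean P (fun o => Z o ^+ 2) (s ^+ 2).
Proof.
have [V ZV] : exists V, has_mean P (fun o => Z o ^+ 2) V.
  apply: has_mean_dominated (measurable_funX 2 mZ) (cosh_mean 1) _ => o.
  rewrite ger0_norm ?sqr_ge0// mul1r.
  by have := expRD_expRN_ge (Z o); lra.
suff -> : s ^+ 2 = V by [].
have s2 : s ^+ 2 = 2 * c by rewrite /c; lra.
have l4 l : 0 < l -> l <= 1 -> c ^+ 2 * (l ^+ 2 * l ^+ 2) <= c ^+ 2 * (l ^+ 2 * l).
  move=> l0 l1; rewrite ler_wpM2l ?sqr_ge0//; nra.
apply/eqP; rewrite eq_le; apply/andP; split.
  apply: (le_of_small_error (k := 16 / 3 * c ^+ 2) c_ge0) => l /andP[l0 l1] cl.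
  (* Write [C y = expR y + expR (- y)]. Since [C y ^+ 2 = C (2 * y) + 2], the product
     [(C y - 2) * (14 - C y)] equals [16 * C y - C (2 * y) - 30], which is linear in exponentials
     and can be averaged. *)
  have : 16 * (2 * expR (l ^+ 2 * s ^+ 2 / 2))
         + (-1 * (2 * expR ((2 * l) ^+ 2 * s ^+ 2 / 2)) + -30)
         <= 12 * l ^+ 2 * V.
    apply: has_mean_le (has_meanZ (12 * l ^+ 2) ZV) _.
      apply: has_meanD (has_meanZ 16 (cosh_mean l)) _.
      exact: has_meanD (has_meanZ (-1) (cosh_mean (2 * l))) (has_mean_cst P (-30)).
    move=> o /=; have := expRD_expRN_le (l * Z o).
    have -> : 2 * l * Z o = l * Z o + l * Z o by ring.
    rewrite (opprD (l * Z o)) !expRD; have := expRxMexpNx_1 (l * Z o).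
    move: (expR (l * Z o)) (expR (- (l * Z o))) (Z o) => a b z ab hz; nra.
  have -> : l ^+ 2 * s ^+ 2 / 2 = c * l ^+ 2 by rewrite /c; ring.
  have := expR_ge1Dx (c * l ^+ 2).
  (* The doubled exponent is why the guard is 1/8: it keeps [c * (2 * l) ^+ 2] below 1/2. The term
     [64 * c ^+ 2 * l ^+ 4] it produces, divided by [12 * l ^+ 2], is the source of 16/3. *)
  have /exp_bound : c * (2 * l) ^+ 2 <= 1 / 2 by lra.
  rewrite s2 exprMn => E4 E1 EV.
  rewrite -(ler_pM2l (exprn_gt0 2 l0)).
  by have := l4 _ l0 l1; nra.
apply: (le_of_small_error (k := 4 * c ^+ 2) c_ge0) => l /andP[l0 l1] cl.
have : 2 + l ^+ 2 * V <= 2 * expR (l ^+ 2 * s ^+ 2 / 2).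
  apply: has_mean_le (has_meanD (has_mean_cst P 2) (has_meanZ (l ^+ 2) ZV))
    (cosh_mean l) _ => o.
  by rewrite -exprMn; exact: expRD_expRN_ge.
have /exp_bound : c * l ^+ 2 <= 1 / 2 by lra.
rewrite s2 => E1 EV.
rewrite -(ler_pM2l (exprn_gt0 2 l0)).
by have := l4 _ l0 l1; nra.
Qed.

End MomentsFromExponentials.

(** * Integration against a measure with a density *)

Section Density.
Context {d : measure_display} {T : measurableType d} {R : realType}.
Variables (mu nu : {measure set T -> \bar R}) (g : T -> R).
Hypotheses (mg : measurable_fun [set: T] g) (g_ge0 : forall x, 0 <= g x)
  (nuE : forall A, measurable A -> nu A = (\int[mu]_(x in A) (g x)%:E)%E).

Import HBNNSimple.

Local Open Scope ereal_scope.

(** For a simple function both sides are finite sums over its values, and [nuE] matches them term by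
    term; monotone convergence along simple approximations of [f] does the rest. *)
Lemma ge0_integral_density (f : T -> \bar R) :
  measurable_fun [set: T] f -> (forall x, 0 <= f x) ->
  \int[nu]_x f x = \int[mu]_x (f x * (g x)%:E).
Proof.
move=> mf f0.
pose f_ := nnsfun_approx measurableT mf.
have cvf x : (f_ n x)%:E @[n --> \oo] --> f x by exact: cvg_nnsfun_approx.
have ndf x : {homo (fun n => (f_ n x)%:E) : m n / (m <= n)%N >-> m <= n}.
  by move=> m n mn; rewrite lee_fin; exact/lefP/nd_nnsfun_approx.
have g0 x : 0 <= (g x)%:E by rewrite lee_fin.
have mfg n : measurable_fun [set: T] (fun x => (f_ n x)%:E * (g x)%:E).
  by apply: emeasurable_funM; exact/measurable_EFinP.
transitivity (limn (fun n => \int[nu]_x (f_ n x)%:E)).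
  rewrite -monotone_convergence//.
  - by apply: eq_integral => x _; exact/esym/cvg_lim.
  - by move=> n; exact/measurable_EFinP.
  - by move=> n x _; rewrite lee_fin.
transitivity (limn (fun n => \int[mu]_x ((f_ n x)%:E * (g x)%:E))); last first.
  rewrite -monotone_convergence//.
  - apply: eq_integral => x _; apply/cvg_lim => //.
    by apply: cvgeZr => //; exact: cvf.
  - by move=> n x _; rewrite mule_ge0// lee_fin.
  - by move=> x _ m n mn; apply: lee_wpmul2r => //; exact: ndf.
congr (limn _); apply/funext => n.
have mfn r : measurable (f_ n @^-1` [set r]) by [].
transitivity (\sum_(r \in range (f_ n)) r%:E * nu (f_ n @^-1` [set r])).
  by rewrite integralT_nnsfun sintegralE.
transitivity (\sum_(r \in range (f_ n))
    \int[mu]_x (r%:E * (\1_(f_ n @^-1` [set r]) x * g x)%:E)); last first.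
  rewrite -ge0_integral_fsum//.
  - apply: eq_integral => x _.
    rewrite [in RHS]fimfunE -fsumEFin// ge0_mule_fsuml; last first.
      by move=> r; rewrite nnfun_muleindic_ge0.
    by apply: eq_fsbigr => r _; rewrite -!EFinM mulrA.
  - move=> r; apply/measurable_EFinP; apply: measurable_funM => //.
    by apply: measurable_funM => //.
  - move=> r x _; rewrite EFinM muleA mule_ge0//.
    exact: nnfun_muleindic_ge0.
apply: eq_fsbigr => r; rewrite inE => -[x _ fxr].
have r0 : (0 <= r)%R by rewrite -fxr.
rewrite ge0_integralZl//.
- rewrite nuE// [in LHS]integral_mkcond; congr (_ * _).
  apply: eq_integral => y _; rewrite epatch_indic.
  by rewrite -EFinM mulrC.
- by apply/measurable_EFinP; apply: measurable_funM.
- by move=> y _; rewrite lee_fin mulr_ge0.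
Qed.

End Density.

(** * Moments of the univariate normal law *)

Section NormalMoments.
Context {R : realType}.

(** Completing the square: [expR (l * (x - m))] times the density of mean [m] is a constant times
    the density of mean [m + l * s ^+ 2], which has integral 1. *)
Lemma integral_normal_prob_expR (m s l : R) : s != 0 ->
  (\int[normal_prob m s]_x (expR (l * (x - m)))%:E
   = (expR (l ^+ 2 * s ^+ 2 / 2))%:E)%E.
Proof.
move=> s0; have s20 : s ^+ 2 != 0 by rewrite expf_neq0.
rewrite (ge0_integral_density (mu := lebesgue_measure) (g := normal_pdf m s)).
- transitivity (\int[lebesgue_measure]_x
      ((expR (l ^+ 2 * s ^+ 2 / 2))%:E * (normal_pdf (m + l * s ^+ 2) s x)%:E))%E.
    apply: eq_integral => x _; rewrite -!EFinM; congr (_%:E).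
    rewrite !normal_pdfE// /normal_fun mulrCA [in RHS]mulrCA -!expRD.
    by congr (_ * expR _); field.
  rewrite ge0_integralZl//; last 2 first.
  - by apply/measurable_EFinP; exact: measurable_normal_pdf.
  - by move=> x _; rewrite lee_fin normal_pdf_ge0.
  by rewrite integral_normal_pdf mule1.
- exact: measurable_normal_pdf.
- exact: normal_pdf_ge0.
- by [].
- apply/measurable_EFinP/measurableT_comp => //.
  by apply: measurable_funM => //; exact: measurable_funB.
- by move=> x; rewrite lee_fin expR_ge0.
Qed.

Context {d : measure_display} {Om : measurableType d}.
Variables (P : probability Om R) (X : Om -> R) (m s : R).
Hypotheses (mX : measurable_fun [set: Om] X) (s0 : s != 0)
  (PX : forall E : set R, measurable E -> P (X @^-1` E) = normal_prob m s E).

Let normal_expR l :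
  has_mean P (fun o => expR (l * (X o - m))) (expR (l ^+ 2 * s ^+ 2 / 2)).
Proof.
have mexp : measurable_fun [set: R] (fun x => expR (l * (x - m))).
  apply: measurableT_comp => //.
  by apply: measurable_funM => //; exact: measurable_funB.
have int : (\int[P]_o (expR (l * (X o - m)))%:E
            = (expR (l ^+ 2 * s ^+ 2 / 2))%:E)%E.
  rewrite -(integral_normal_prob_expR m l s0).
  (* [R] and [measurableTypeR R] have the same measurable sets but different
     displays, and [normal_prob] is a measure on the latter. *)
  have mX' : measurable_fun [set: Om] (X : Om -> measurableTypeR R) by exact: mX.
  pose Xm : {RV P >-> measurableTypeR R} :=
    HB.pack (X : Om -> measurableTypeR R) (isMeasurableFun.Build _ _ _ _ _ mX').
  rewrite -(ge0_integral_distribution Xm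
              (f := fun x : measurableTypeR R => (expR (l * (x - m)))%:E)).
  - by apply: eq_measure_integral => E mE _; exact: PX.
  - exact/measurable_EFinP.
  - by move=> x; rewrite lee_fin expR_ge0.
split=> //; apply/integrableP; split.
  exact/measurable_EFinP/(measurableT_comp mexp).
under eq_integral => o _ do rewrite /= ger0_norm ?expR_ge0//.
by rewrite int ltry.
Qed.

Let mXm : measurable_fun [set: Om] (fun o => X o - m).
Proof. exact: measurable_funB. Qed.

Lemma normal_mean : has_mean P X m.
Proof.
have := has_meanD (centered_mean mXm normal_expR) (has_mean_cst P m).
by rewrite add0r; apply: eq_has_mean => o; rewrite subrK.
Qed.

Lemma normal_second_moment : has_mean P (fun o => X o ^+ 2) (m ^+ 2 + s ^+ 2).
Proof.
have Z2 := centered_second_moment mXm normal_expR.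
have := has_meanD Z2 (has_meanD (has_meanZ (2 * m) normal_mean)
                                (has_mean_cst P (- m ^+ 2))).
have -> : s ^+ 2 + (2 * m * m - m ^+ 2) = m ^+ 2 + s ^+ 2 by ring.
by apply: eq_has_mean => o; ring.
Qed.

End NormalMoments.

(** * Mean of a product of independent variables *)

Section Independence.
Context {R : realType} {d : measure_display} {Om : measurableType d}.
Variables (P : probability Om R) (X Y : Om -> R).
Hypotheses (mX : measurable_fun [set: Om] X) (mY : measurable_fun [set: Om] Y)
  (indXY : forall E F : set R, measurable E -> measurable F ->
     P (X @^-1` E `&` Y @^-1` F) = (P (X @^-1` E) * P (Y @^-1` F))%E).

Let Xm : {RV P >-> R} := HB.pack X (isMeasurableFun.Build _ _ _ _ _ mX).
Let Ym : {RV P >-> R} := HB.pack Y (isMeasurableFun.Build _ _ _ _ _ mY).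

(** The law of the pair agrees with the product law on rectangles, hence everywhere, and Fubini
    factors the integral. Integrability of the product enters as a hypothesis. *)
Lemma independent_has_meanM (m k c : R) :
  has_mean P X m -> has_mean P Y k -> has_mean P (fun o => X o * Y o) c ->
  c = m * k.
Proof.
move=> [iX eX] [iY eY] [iXY eXY].
have mXY : measurable_fun [set: Om] (fun o => (X o, Y o)).
  exact: measurable_fun_pair.
pose XY : {RV P >-> (R * R)%type} :=
  HB.pack (fun o => (X o, Y o)) (isMeasurableFun.Build _ _ _ _ _ mXY).
pose f (z : R * R) := (z.1 * z.2)%:E.
have mf : measurable_fun [set: R * R] f.
  by apply/measurable_EFinP; apply: measurable_funM.
pose PX := distribution P Xm; pose PY := distribution P Ym.
have prodE A : measurable A -> (PX \x PY)%E A = distribution P XY A.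
  by apply: product_measure_unique => E F mE mF; exact: indXY.
have integrable_id (Z : {RV P >-> R}) : P.-integrable [set: Om] (EFin \o Z) ->
    (distribution P Z).-integrable [set: R] EFin.
  by move=> iZ; apply: integrable_pushforward.
have if_ : (PX \x PY)%E.-integrable [set: R * R] f.
  have : (distribution P XY).-integrable [set: R * R] f.
    by apply: integrable_pushforward.
  move=> /integrableP[_ fin]; apply/integrableP; split=> //.
  rewrite (eq_measure_integral (distribution P XY)) => [//|A mA _].
  exact: prodE.
have : (\int[PX \x PY]_z f z = c%:E)%E.
  rewrite (eq_measure_integral (distribution P XY)); last first.
    by move=> A mA _; exact: prodE.
  by rewrite integral_distribution.
rewrite -integral12_prod_meas1// /fubini_F /f/=.
have -> : (fun x => \int[PY]_y (x * y)%:E)%E = (fun x => k%:E * x%:E)%E.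
  apply/funext => x; under eq_integral do rewrite EFinM.
  rewrite integralZl//; last exact: integrable_id.
  by rewrite integral_distribution// eY muleC.
rewrite integralZl//; last exact: integrable_id.
by rewrite integral_distribution// eX -EFinM mulrC => -[].
Qed.

End Independence.

(** * Bilinearity of the dot product *)

Section DotProduct.
Context {R : realType}.

Lemma dotcE d (x y : 'cV[R]_d) : dotc x y = \sum_i x i 0 * y i 0.
Proof. by rewrite /dotc mxE; apply: eq_bigr => i _; rewrite mxE. Qed.

Lemma dotcC d (x y : 'cV[R]_d) : dotc x y = dotc y x.
Proof. by rewrite !dotcE; apply: eq_bigr => i _; rewrite mulrC. Qed.

Lemma dotcDl d (x y z : 'cV[R]_d) : dotc (x + y) z = dotc x z + dotc y z.
Proof. by rewrite /dotc linearD mulmxDl mxE. Qed.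

Lemma dotcDr d (x y z : 'cV[R]_d) : dotc x (y + z) = dotc x y + dotc x z.
Proof. by rewrite /dotc mulmxDr mxE. Qed.

Lemma dotcZl d k (x y : 'cV[R]_d) : dotc (k *: x) y = k * dotc x y.
Proof. by rewrite /dotc linearZ -scalemxAl mxE. Qed.

Lemma dotcZr d k (x y : 'cV[R]_d) : dotc x (k *: y) = k * dotc x y.
Proof. by rewrite dotcC dotcZl dotcC. Qed.

Lemma dotcNl d (x y : 'cV[R]_d) : dotc (- x) y = - dotc x y.
Proof. by rewrite -scaleN1r dotcZl mulN1r. Qed.

Lemma dotcNr d (x y : 'cV[R]_d) : dotc x (- y) = - dotc x y.
Proof. by rewrite dotcC dotcNl dotcC. Qed.

Lemma dotc0l d (y : 'cV[R]_d) : dotc 0 y = 0.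
Proof. by rewrite -(scale0r 0) dotcZl mul0r. Qed.

Lemma dotc0r d (y : 'cV[R]_d) : dotc y 0 = 0.
Proof. by rewrite dotcC dotc0l. Qed.

Lemma dotc_mulmx m n (S : 'M[R]_(m, n)) x y :
  dotc x (S *m y) = dotc (S^T *m x) y.
Proof. by rewrite /dotc trmx_mul trmxK mulmxA. Qed.

Lemma dotc_sym d (S : 'M[R]_d) x y :
  S^T = S -> dotc x (S *m y) = dotc y (S *m x).
Proof. by move=> S_sym; rewrite dotc_mulmx S_sym dotcC. Qed.

Lemma dotc_delta d (i : 'I_d) (x : 'cV[R]_d) : dotc (delta_mx i 0) x = x i 0.
Proof.
rewrite dotcE (bigD1 i)//= mxE !eqxx mul1r big1 ?addr0// => j /negPf ji.
by rewrite mxE ji mul0r.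
Qed.

End DotProduct.

Arguments dotc_sym {R d} S.

(** * Moments of Gaussian vectors *)

Section GaussianVectorMoments.
Context {R : realType} {disp : measure_display} {Om : measurableType disp}.
Variable P : probability Om R.

Lemma measurable_dotc d disp' (T : measurableType disp') (c : 'cV[R]_d)
    (X : T -> 'cV[R]_d) :
  (forall i, measurable_fun [set: T] (fun o => X o i 0 : R)) ->
  measurable_fun [set: T] (fun o => dotc c (X o)).
Proof.
move=> mX; under eq_fun do rewrite dotcE.
by apply: measurable_sum => i; apply: measurable_funM.
Qed.

(** A linear form is a finite combination of coordinates, so it is measurable for the sigma-algebra
    they generate; this passes independence from vectors to their linear forms. *)
Lemma borel_cV_dotc d (c : 'cV[R]_d) (E : set R) : measurable E ->
  borel_cV [set x : 'cV[R]_d | E (dotc c x)].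
Proof.
move=> mE.
pose G := \big[setU/set0]_(i < d) preimage_set_system [set: 'cV[R]_d]
  (fun x : 'cV[R]_d => x i 0 : R) measurable.
have mcoord (i : 'I_d) :
    measurable_fun [set: g_sigma_algebraType G] (fun x => x i 0 : R).
  move=> _ F mF; rewrite setTI; apply: sub_sigma_algebra.
  rewrite /G -bigcup_seq/=; exists i => /=; first by rewrite mem_index_enum.
  by exists F => //; rewrite setTI.
have := measurable_dotc c mcoord measurableT mE.
by rewrite setTI.
Qed.

Lemma gaussian_dotc_mean d (X : Om -> 'cV[R]_d) mu S (c : 'cV[R]_d) :
  gaussian_vector P X mu S -> posdef S ->
  has_mean P (fun o => dotc c (X o)) (dotc c mu).
Proof.
(* [gaussian_vector] speaks only of nonzero [c], so [c = 0] is treated as a constant; otherwise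
   positive definiteness makes the standard deviation nonzero. *)
move=> [mX normX] [_ S_gt0]; have [->|c0] := eqVneq c 0.
  by rewrite dotc0l; under eq_fun do rewrite dotc0l; exact: has_mean_cst.
apply: normal_mean (measurable_dotc c mX) _ (normX c c0).
by rewrite sqrtr_eq0 -ltNge S_gt0.
Qed.

Lemma gaussian_dotc_second_moment d (X : Om -> 'cV[R]_d) mu S (c : 'cV[R]_d) :
  gaussian_vector P X mu S -> posdef S ->
  has_mean P (fun o => dotc c (X o) ^+ 2) (dotc c mu ^+ 2 + dotc c (S *m c)).
Proof.
move=> [mX normX] [_ S_gt0]; have [->|c0] := eqVneq c 0.
  rewrite !dotc0l expr0n addr0; under eq_fun do rewrite dotc0l expr0n.
  exact: has_mean_cst.
have Sc := S_gt0 c c0.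
have := normal_second_moment (measurable_dotc c mX) _ (normX c c0).
by rewrite sqr_sqrtr ?ltW//; apply; rewrite sqrtr_eq0 -ltNge.
Qed.

Lemma independent_dotc_mean d e (X : Om -> 'cV[R]_d) (Y : Om -> 'cV[R]_e)
    muX muY SX SY (b : 'cV[R]_d) (c : 'cV[R]_e) :
  gaussian_vector P X muX SX -> posdef SX ->
  gaussian_vector P Y muY SY -> posdef SY -> independent_vectors P X Y ->
  has_mean P (fun o => dotc b (X o) * dotc c (Y o)) (dotc b muX * dotc c muY).
Proof.
move=> gX pX gY pY indXY.
have mX := measurable_dotc b gX.1; have mY := measurable_dotc c gY.1.
have X2 := gaussian_dotc_second_moment b gX pX.
have Y2 := gaussian_dotc_second_moment c gY pY.
have [k XYk] : exists k, has_mean P (fun o => dotc b (X o) * dotc c (Y o)) k.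
  apply: has_mean_dominated _ (has_meanD X2 Y2) _; first exact: measurable_funM.
  move=> o; have := sqr_ge0 (dotc b (X o) - dotc c (Y o)).
  have := sqr_ge0 (dotc b (X o) + dotc c (Y o)).
  by move=> ? ?; rewrite ler_norml; apply/andP; split; nra.
suff <- : k = dotc b muX * dotc c muY by [].
apply: (independent_has_meanM mX mY _ (gaussian_dotc_mean b gX pX)
          (gaussian_dotc_mean c gY pY) XYk) => E F mE mF.
exact: indXY (borel_cV_dotc b mE) (borel_cV_dotc c mF).
Qed.

Section QuadraticForms.
Context {d : nat}.
Variables (Y : Om -> 'cV[R]_d) (mu : 'cV[R]_d) (S : 'M[R]_d).
Hypotheses (S_sym : S^T = S)
  (Y2 : forall c, has_mean P (fun o => dotc c (Y o) ^+ 2)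
                             (dotc c mu ^+ 2 + dotc c (S *m c))).

Let coord_mulS i j : dotc (delta_mx i 0) (S *m delta_mx j 0) = S i j.
Proof.
rewrite dotc_delta mxE (bigD1 j)//= mxE !eqxx mulr1 big1 ?addr0// => k /negPf kj.
by rewrite mxE kj mulr0.
Qed.

(** Polarization of [Y2] along the sum of two basis vectors. *)
Lemma coord_product_mean i j :
  has_mean P (fun o => Y o i 0 * Y o j 0) (mu i 0 * mu j 0 + S i j).
Proof.
have Sji : S j i = S i j by rewrite -[in RHS]S_sym mxE.
have := has_meanZ (1 / 2) (has_meanD (Y2 (delta_mx i 0 + delta_mx j 0))
  (has_meanZ (-1) (has_meanD (Y2 (delta_mx i 0)) (Y2 (delta_mx j 0))))).
rewrite !mulmxDr !dotcDl !dotcDr !coord_mulS !dotc_delta Sji.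
set m := (X in has_mean _ _ X) => H.
have -> : mu i 0 * mu j 0 + S i j = m by rewrite /m; field.
by apply: eq_has_mean H => o; rewrite dotcDl !dotc_delta; field.
Qed.

(** Only second moments of linear forms are assumed, so this applies to the next state without
    showing that a sum of independent Gaussian vectors is Gaussian. *)
Lemma quadratic_mean (Q : 'M[R]_d) :
  has_mean P (fun o => dotc (Y o) (Q *m Y o)) (dotc mu (Q *m mu) + \tr (S *m Q)).
Proof.
have quadE (y : 'cV[R]_d) :
    dotc y (Q *m y) = \sum_i \sum_j Q i j * (y i 0 * y j 0).
  rewrite dotcE; apply: eq_bigr => i _; rewrite mxE mulr_sumr.
  by apply: eq_bigr => j _; ring.
have -> : dotc mu (Q *m mu) + \tr (S *m Q)
    = \sum_i \sum_j Q i j * (mu i 0 * mu j 0 + S i j).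
  rewrite quadE mxtrace_mulC /mxtrace -big_split/=.
  apply: eq_bigr => i _; rewrite mxE -big_split/=; apply: eq_bigr => j _.
  by rewrite -[in RHS]S_sym mxE mulrDr.
apply: eq_has_mean (has_mean_sum _ _) => [om|i]; first by rewrite quadE.
by apply: has_mean_sum => j; apply: has_meanZ; exact: coord_product_mean.
Qed.

End QuadraticForms.

End GaussianVectorMoments.

(** * Expected quadratic function of the next state *)

Section StageExpectation.
Context {R : realType} {dx du : nat} (D : lq_data R dx du).
Context {disp : measure_display} {Om : measurableType disp}.
Variables (t : nat) (P : 'M[R]_dx) (p : 'cV[R]_dx) (r : R).
Variables (Pr : probability Om R) (w : Om -> 'cV[R]_dx) (v : Om -> 'cV[R]_du)
  (g : 'cV[R]_dx) (e : 'cV[R]_du).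
Hypotheses (Lam_pd : posdef (lq_Lam D t)) (Xi_pd : posdef (lq_Xi D t))
  (gauss_w : gaussian_vector Pr w g (lq_Lam D t))
  (gauss_v : gaussian_vector Pr v e (lq_Xi D t))
  (ind_wv : independent_vectors Pr w v).

(** The covariance matrix of the next state. *)
Let S : 'M[R]_dx := lq_B D *m lq_Xi D t *m (lq_B D)^T + lq_Lam D t.

Lemma next_state_quadratic_mean x u :
  let y := next_state D x u g e in
  has_mean Pr
    (fun o => let Y := next_state D x u (w o) (v o) in
       2^-1 * dotc Y (P *m Y) + dotc Y p + r)
    (2^-1 * dotc y (P *m y) + dotc y p + r + 2^-1 * \tr (S *m P)).
Proof.
move=> y.
have S_sym : S^T = S.
  by rewrite /S linearD/= !trmx_mul trmxK Lam_pd.1 Xi_pd.1 mulmxA.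
have dotcY c w' v' : dotc c (next_state D x u w' v')
    = dotc c (lq_a D + lq_A D *m x + lq_B D *m u)
      + (dotc ((lq_B D)^T *m c) v' + dotc c w').
  by rewrite -dotc_mulmx -!dotcDr /next_state mulmxDr !addrA.
have Y1 c : has_mean Pr (fun o => dotc c (next_state D x u (w o) (v o))) (dotc c y).
  rewrite dotcY; under eq_fun do rewrite dotcY.
  apply: has_meanD (has_mean_cst _ _) (has_meanD _ _).
  - exact: gaussian_dotc_mean gauss_v Xi_pd.
  - exact: gaussian_dotc_mean gauss_w Lam_pd.
have Y2 c : has_mean Pr (fun o => dotc c (next_state D x u (w o) (v o)) ^+ 2)
    (dotc c y ^+ 2 + dotc c (S *m c)).
  pose k := dotc c (lq_a D + lq_A D *m x + lq_B D *m u).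
  have V1 := gaussian_dotc_mean ((lq_B D)^T *m c) gauss_v Xi_pd.
  have W1 := gaussian_dotc_mean c gauss_w Lam_pd.
  have V2 := gaussian_dotc_second_moment ((lq_B D)^T *m c) gauss_v Xi_pd.
  have W2 := gaussian_dotc_second_moment c gauss_w Lam_pd.
  have WV := independent_dotc_mean c ((lq_B D)^T *m c) gauss_w Lam_pd
    gauss_v Xi_pd ind_wv.
  (* These are the terms of [(k + V + W) ^+ 2], with [k] deterministic and [V], [W] the two noise
     contributions; independence gives the mean of the cross term. *)
  have := has_meanD (has_meanD (has_mean_cst Pr (k ^+ 2))
    (has_meanZ (2 * k) (has_meanD V1 W1)))
    (has_meanD (has_meanD V2 W2) (has_meanZ 2 WV)).
  set m := (X in has_mean _ _ X) => H.
  have -> : dotc c y ^+ 2 + dotc c (S *m c) = m.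
    rewrite dotcY -/k /m /S mulmxDl dotcDr.
    by rewrite -!mulmxA (dotc_mulmx (lq_B D) c); ring.
  by apply: eq_has_mean H => o; rewrite dotcY -/k; ring.
have := has_meanD (has_meanD (has_meanZ 2^-1 (quadratic_mean S_sym Y2 P))
  (Y1 p)) (has_mean_cst Pr r).
set m := (X in has_mean _ _ X) => H.
have -> : 2^-1 * dotc y (P *m y) + dotc y p + r + 2^-1 * \tr (S *m P) = m.
  by rewrite /m (dotcC p); ring.
by apply: eq_has_mean H => o /=; rewrite (dotcC p).
Qed.

End StageExpectation.

(** * Positive definite matrices *)

Section PositiveDefinite.
Context {R : realType}.

Lemma mulmx_kernel0_unitmx d (S : 'M[R]_d) :
  (forall x : 'cV[R]_d, S *m x = 0 -> x = 0) -> S \in unitmx.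
Proof.
move=> S0; rewrite -unitmx_tr -row_free_unit -kermx_eq0; apply/eqP/row_matrixP => i.
apply: trmx_inj; rewrite row0 trmx0; apply: S0.
by apply: trmx_inj; rewrite trmx_mul trmxK trmx0 -row_mul mulmx_ker row0.
Qed.

Lemma posdef_unitmx d (S : 'M[R]_d) : posdef S -> S \in unitmx.
Proof.
move=> [_ S_gt0]; apply: mulmx_kernel0_unitmx => x Sx; apply/eqP; apply: contraT.
by move=> /S_gt0; rewrite Sx dotc0r ltxx.
Qed.

Lemma posdef_invmx d (S : 'M[R]_d) : posdef S -> posdef (invmx S).
Proof.
move=> S_pd; have uS := posdef_unitmx S_pd; split.
  by rewrite trmx_inv S_pd.1.
move=> x x0; pose y := invmx S *m x.
have xE : x = S *m y by rewrite mulKVmx.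
rewrite -/y [X in dotc X _]xE dotcC S_pd.2//.
by apply: contraNneq x0 => y0; rewrite xE y0 mulmx0.
Qed.

Lemma posdef_ge0 d (S : 'M[R]_d) x : posdef S -> 0 <= dotc x (S *m x).
Proof.
have [->|x0 S_pd] := eqVneq x 0; first by rewrite dotc0l.
by rewrite ltW// S_pd.2.
Qed.

Lemma dotc_eq0 d (y : 'cV[R]_d) : (forall x, dotc x y = 0) -> y = 0.
Proof.
by move=> y0; apply/colP => i; rewrite -dotc_delta y0 mxE.
Qed.

Lemma dotc_col_mx m n (a c : 'cV[R]_m) (b d : 'cV[R]_n) :
  dotc (col_mx a b) (col_mx c d) = dotc a c + dotc b d.
Proof. by rewrite /dotc tr_col_mx mul_row_col mxE. Qed.

End PositiveDefinite.

(** * Saddle point of a convex-concave quadratic form *)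

Section Saddle.
Context {R : realType} {dx du : nat}.
Variables (B1 B3 : 'M[R]_du) (B2 : 'M[R]_dx) (C : 'M[R]_(du, dx))
  (b1 : 'cV[R]_du) (b2 : 'cV[R]_dx).

(* [stage_F D t P p x] is convertible to an instance of this form. *)
Definition saddle_form (z : 'cV[R]_du * 'cV[R]_dx * 'cV[R]_du) : R :=
  let: (u, g, e) := z in
  2^-1 * dotc u (B1 *m u) + dotc u b1
  + 2^-1 * dotc g (B2 *m g) + dotc g b2
  + 2^-1 * dotc e (B3 *m e) + dotc e b1
  + dotc u (C *m g) + dotc u (B1 *m e) + dotc e (C *m g).

Definition saddle_grad (z h : 'cV[R]_du * 'cV[R]_dx * 'cV[R]_du) : R :=
  dotc h.1.1 (B1 *m z.1.1 + b1 + C *m z.1.2 + B1 *m z.2)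
  + dotc h.1.2 (B2 *m z.1.2 + b2 + C^T *m (z.1.1 + z.2))
  + dotc h.2 (B3 *m z.2 + b1 + B1 *m z.1.1 + C *m z.1.2).

Definition saddle_hess (h : 'cV[R]_du * 'cV[R]_dx * 'cV[R]_du) : R :=
  2^-1 * dotc h.1.1 (B1 *m h.1.1) + 2^-1 * dotc h.1.2 (B2 *m h.1.2)
  + 2^-1 * dotc h.2 (B3 *m h.2)
  + dotc h.1.1 (C *m h.1.2) + dotc h.1.1 (B1 *m h.2) + dotc h.2 (C *m h.1.2).

(** For stage [t] the matrix [B1 - B3] is the inverse of [Xi t]; its invertibility forces [e = 0] at
    a critical point. *)
Hypotheses (B1_pd : posdef B1) (B13_pd : posdef (B1 - B3))
  (block_pd : posdef (- block_mx B2 C^T C B3)).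

Let B1_sym : B1^T = B1 := B1_pd.1.

Let B3_sym : B3^T = B3.
Proof.
have := B13_pd.1; rewrite linearB/= B1_sym => /addrI/oppr_inj; exact.
Qed.

Let B2_sym : B2^T = B2.
Proof.
have := block_pd.1; rewrite linearN/= tr_block_mx trmxK => /oppr_inj.
by move=> /eq_block_mx[].
Qed.

(** The second-order Taylor expansion, exact for a quadratic; [saddle_hess] already contains the
    factor 1/2. Symmetry of the three matrices merges the cross terms into the gradient. *)
Lemma saddle_form_add z h :
  saddle_form (z + h) = saddle_form z + saddle_grad z h + saddle_hess h.
Proof.
case: z h => [[u g] e] [[hu hg] he]; rewrite /saddle_form /saddle_grad /saddle_hess/=.
rewrite !mulmxDr !dotcDl !dotcDr.
rewrite (dotc_mulmx B1 u hu) (dotc_mulmx B2 g hg) (dotc_mulmx B3 e he).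
rewrite B1_sym B2_sym B3_sym (dotcC _ hu) (dotcC _ hg) (dotcC _ he).
rewrite (dotc_mulmx C u hg) (dotc_mulmx C e hg) (dotcC _ hg) (dotcC _ hg).
rewrite (dotc_mulmx B1 u he) B1_sym (dotcC _ he).
by field.
Qed.

Lemma saddle_hess_outer hu : 0 <= saddle_hess (hu, 0, 0).
Proof.
rewrite /saddle_hess/= !mulmx0 !dotc0r !mulr0 !addr0.
by rewrite mulr_ge0// posdef_ge0.
Qed.

(** Translates the block matrix condition into strict concavity in [(g, e)]. *)
Lemma block_form hg he : dotc (col_mx hg he) (- block_mx B2 C^T C B3 *m col_mx hg he)
  = - (2 * saddle_hess (0, hg, he)).
Proof.
rewrite mulNmx dotcNr mul_block_col dotc_col_mx !dotcDr.
rewrite (dotc_mulmx (C^T) hg) trmxK (dotcC (C *m hg)) /saddle_hess/= !dotc0l.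
by field.
Qed.

Lemma saddle_hess_inner hg he : saddle_hess (0, hg, he) <= 0.
Proof.
have [h0|h0] := eqVneq (col_mx hg he) 0.
  by have := block_form hg he; rewrite h0 dotc0l; lra.
by have := block_pd.2 _ h0; rewrite block_form; lra.
Qed.

Lemma inner_block_neg g : g != 0 -> dotc g (B2 *m g) < 0.
Proof.
move=> g0; have h0 : col_mx g (0 : 'cV[R]_du) != 0.
  by apply: contraNneq g0 => /eqP; rewrite col_mx_eq0 => /andP[].
have := block_pd.2 _ h0; rewrite block_form /saddle_hess/=.
by rewrite !dotc0l; lra.
Qed.

(** Minus the Schur complement of [B1] in the block matrix with rows [B1, C] and [C^T, B2]. *)
Definition saddle_G : 'M[R]_dx := C^T *m invmx B1 *m C - B2.

(** The first summand is positive semidefinite, and [- B2] is positive definite as a diagonal block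
    of the matrix in [block_pd]. *)
Lemma saddle_G_pd : posdef saddle_G.
Proof.
split.
  by rewrite /saddle_G linearB/= !trmx_mul trmxK trmx_inv B1_sym B2_sym mulmxA.
move=> x x0; rewrite mulmxBl dotcDr dotcNr -!mulmxA dotc_mulmx trmxK.
have := posdef_ge0 (C *m x) (posdef_invmx B1_pd); have := inner_block_neg x0; lra.
Qed.

Definition saddle_g : 'cV[R]_dx :=
  invmx saddle_G *m (b2 - C^T *m (invmx B1 *m b1)).

Definition saddle_u : 'cV[R]_du := - (invmx B1 *m (b1 + C *m saddle_g)).

Lemma saddle_gradE z : (forall h, saddle_grad z h = 0) <->
  [/\ B1 *m z.1.1 + b1 + C *m z.1.2 + B1 *m z.2 = 0,
      B2 *m z.1.2 + b2 + C^T *m (z.1.1 + z.2) = 0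
    & B3 *m z.2 + b1 + B1 *m z.1.1 + C *m z.1.2 = 0].
Proof.
split=> [grad0|[E1 E2 E3] h]; last by rewrite /saddle_grad E1 E2 E3 !dotc0r !addr0.
split; apply: dotc_eq0 => x.
- by rewrite -(grad0 (x, 0, 0)) /saddle_grad/= !dotc0l !addr0.
- by rewrite -(grad0 (0, x, 0)) /saddle_grad/= !dotc0l addr0 add0r.
- by rewrite -(grad0 (0, 0, x)) /saddle_grad/= !dotc0l !add0r.
Qed.

Lemma saddle_grad_eq0 z :
  (forall h, saddle_grad z h = 0) <-> z = (saddle_u, saddle_g, 0).
Proof.
have uB1 := posdef_unitmx B1_pd; have uG := posdef_unitmx saddle_G_pd.
rewrite saddle_gradE; case: z => [[u g] e] /=.
split=> [[E1 E2 E3]|[-> -> ->]]; last first.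
  rewrite !mulmx0 !addr0 add0r.
  have E1 : B1 *m saddle_u + b1 + C *m saddle_g = 0.
    by rewrite -addrA mulmxN mulKVmx// addNr.
  (* With [e = 0] the third equation is the first one reordered. *)
  split=> //; last by rewrite addrC (addrC b1) -E1 addrC.
  have : saddle_G *m saddle_g = b2 - C^T *m (invmx B1 *m b1) by rewrite mulKVmx.
  rewrite /saddle_u {1}/saddle_G mulmxBl mulmxN !mulmxDr -!mulmxA.
  move: (C^T *m _) (B2 *m _) (C^T *m _) => X Y Z /colP EG.
  by apply/colP => i; move: (EG i); rewrite !mxE; lra.
have e0 : e = 0.
  apply: (can_inj (mulKmx (posdef_unitmx B13_pd))); rewrite mulmx0 mulmxBl.
  move/colP: E1; move/colP: E3.
  move: (B1 *m u) (C *m g) (B1 *m e) (B3 *m e) => X Y Z T E3 E1.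
  by apply/colP => i; move: (E1 i) (E3 i); rewrite !mxE; lra.
rewrite e0 in E1 E2 E3 *; rewrite mulmx0 addr0 in E1; rewrite addr0 in E2.
have uE : u = - (invmx B1 *m (b1 + C *m g)).
  rewrite -(mulKmx uB1 u) -mulmxN; congr (_ *m _).
  by apply/eqP; rewrite -addr_eq0 addrA E1.
suff gE : g = saddle_g by rewrite /saddle_u -gE -uE.
rewrite /saddle_g; apply: (can_inj (mulKmx uG)); rewrite mulKVmx//.
move/colP: E2; rewrite uE /saddle_G mulmxBl mulmxN !mulmxDr -!mulmxA.
move: (C^T *m _) (B2 *m _) (C^T *m _) => X Y Z EG.
by apply/colP => i; move: (EG i); rewrite !mxE; lra.
Qed.

(** Euler's identity [homog]: the form has parts of degrees 2 and 1 only, so where the gradient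
    vanishes its value is half the linear part. *)
Lemma saddle_form_critical : saddle_form (saddle_u, saddle_g, 0) =
  - (2^-1 * dotc b1 (invmx B1 *m b1))
  + 2^-1 * dotc (b2 - C^T *m (invmx B1 *m b1))
                (invmx saddle_G *m (b2 - C^T *m (invmx B1 *m b1))).
Proof.
have homog z : saddle_form z = 2^-1 * saddle_grad z z
    + 2^-1 * (dotc z.1.1 b1 + dotc z.1.2 b2 + dotc z.2 b1).
  case: z => [[u g] e]; rewrite /saddle_form /saddle_grad/= !mulmxDr !dotcDr.
  rewrite (dotc_mulmx C^T g u) (dotc_mulmx C^T g e) trmxK.
  rewrite (dotc_mulmx B1 e u) B1_sym (dotcC (B1 *m e)) !(dotcC (C *m g)).
  by field.
rewrite homog ((saddle_grad_eq0 _).2 erefl) mulr0 add0r/= -/saddle_g dotc0l addr0.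
rewrite (_ : dotc saddle_u b1 = - dotc b1 (invmx B1 *m b1)
    - dotc (C^T *m (invmx B1 *m b1)) saddle_g); last first.
  rewrite /saddle_u dotcNl dotcC mulmxDr dotcDr opprD; congr (_ - _).
  by rewrite -[in RHS]B1_sym -trmx_inv -!dotc_mulmx.
by rewrite dotcDl dotcNl (dotcC saddle_g); ring.
Qed.

(** [B2] is negative definite, hence invertible, so the [g]-equation can be solved for [g] in terms
    of [u], in the shape of the stated formula for the optimal control. *)
Lemma saddle_gE : saddle_g = - (invmx B2 *m (b2 + C^T *m saddle_u)).
Proof.
have uB2 : B2 \in unitmx.
  apply: mulmx_kernel0_unitmx => x B2x; apply/eqP; apply: contraT => /inner_block_neg.
  by rewrite B2x dotc0r ltxx.
have /saddle_gradE[_ + _] := (saddle_grad_eq0 _).2 erefl.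
rewrite /= addr0 -addrA => /eqP; rewrite addr_eq0 => /eqP E2.
by rewrite -(mulKmx uB2 saddle_g) E2 mulmxN.
Qed.

Lemma saddle_le_outer u : 
  saddle_form (saddle_u, saddle_g, 0) <= saddle_form (u, saddle_g, 0).
Proof.
have -> : (u, saddle_g, 0 : 'cV[R]_du)
    = (saddle_u, saddle_g, 0) + (u - saddle_u, 0, 0).
  by congr (_, _, _); rewrite /= ?addr0// addrC subrK.
rewrite saddle_form_add ((saddle_grad_eq0 _).2 erefl) addr0 lerDl.
exact: saddle_hess_outer.
Qed.

Lemma saddle_inner_le g e :
  saddle_form (saddle_u, g, e) <= saddle_form (saddle_u, saddle_g, 0).
Proof.
have -> : (saddle_u, g, e) = (saddle_u, saddle_g, 0) + (0, g - saddle_g, e).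
  by congr (_, _, _); rewrite /= ?addr0 ?add0r// addrC subrK.
rewrite saddle_form_add ((saddle_grad_eq0 _).2 erefl) addr0 gerDl.
exact: saddle_hess_inner.
Qed.

(** For the upper bound the infimum is tested at [saddle_u]; for the lower bound each supremum is
    tested at [(saddle_g, 0)]. *)
Lemma saddle_value k :
  ereal_inf (range (fun u : 'cV[R]_du =>
    ereal_sup (range (fun ge : 'cV[R]_dx * 'cV[R]_du =>
      (saddle_form (u, ge.1, ge.2) + k)%:E))))
  = (saddle_form (saddle_u, saddle_g, 0) + k)%:E.
Proof.
apply/eqP; rewrite eq_le; apply/andP; split.
  apply: ge_ereal_inf; exists (ereal_sup (range (fun ge : 'cV[R]_dx * 'cV[R]_du =>
      (saddle_form (saddle_u, ge.1, ge.2) + k)%:E))); first by exists saddle_u.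
  apply: ge_ereal_sup => _ [[g e] _ <-]/=.
  by rewrite lee_fin lerD2r saddle_inner_le.
apply: le_ereal_inf_tmp => _ [u _ <-]; apply: le_ereal_sup_tmp.
exists ((saddle_form (u, saddle_g, 0) + k)%:E); first by exists (saddle_g, 0).
by rewrite lee_fin lerD2r saddle_le_outer.
Qed.

End Saddle.

(** * Stationarity in the sense of differentials *)

Section SaddleStationary.
Context {R : realType}.

Lemma differentiable_linear (V W : normedModType R) (f : V -> W) (z : V) :
  linear f -> continuous f -> differentiable f z.
Proof.
move=> lf cf; pose F : {linear V -> W} :=
  HB.pack f (GRing.isLinear.Build _ _ _ _ _ lf).
exact: (@linear_differentiable _ _ _ F).
Qed.

Lemma differentiable_dotc (V : normedModType R) d (f g : V -> 'cV[R]_d) (z : V) :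
  (forall i, differentiable (fun y => f y i 0 : R) z) ->
  (forall i, differentiable (fun y => g y i 0 : R) z) ->
  differentiable (fun y => dotc (f y) (g y)) z.
Proof.
move=> df dg; under eq_fun do rewrite dotcE.
rewrite -[X in differentiable X _]fct_sumE.
by apply: differentiable_sum => i; exact: differentiableM.
Qed.

Lemma differentiable_mulmx (V : normedModType R) m n (S : 'M[R]_(m, n))
    (f : V -> 'cV[R]_n) (z : V) :
  (forall i, differentiable (fun y => f y i 0 : R) z) ->
  forall i, differentiable (fun y => (S *m f y) i 0 : R) z.
Proof.
move=> df i; under eq_fun do rewrite mxE.
rewrite -[X in differentiable X _]fct_sumE.
by apply: differentiable_sum => j; apply: differentiableM.
Qed.

Context {dx du : nat}.
Variables (B1 B3 : 'M[R]_du) (B2 : 'M[R]_dx) (C : 'M[R]_(du, dx))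
  (b1 : 'cV[R]_du) (b2 : 'cV[R]_dx).

Local Notation V := ('cV[R]_du * 'cV[R]_dx * 'cV[R]_du)%type.

(** The form is a polynomial in the coordinates, which are continuous linear maps. *)
Lemma differentiable_saddle_form (z : V) :
  differentiable (saddle_form B1 B3 B2 C b1 b2 : V -> R^o) z.
Proof.
have du_ i : differentiable (fun y : V => y.1.1 i 0 : R) z.
  apply: differentiable_linear => [k x y|x]; first by rewrite !mxE.
  apply: (@continuous_comp _ _ _ (fun y : V => y.1.1) (fun u => u i 0)).
    by apply: (@continuous_comp _ _ _ (fun y : V => y.1) fst); exact: cvg_fst.
  exact: coord_continuous.
have dg_ i : differentiable (fun y : V => y.1.2 i 0 : R) z.
  apply: differentiable_linear => [k x y|x]; first by rewrite !mxE.
  apply: (@continuous_comp _ _ _ (fun y : V => y.1.2) (fun u => u i 0)).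
    apply: (@continuous_comp _ _ _ (fun y : V => y.1) snd).
      exact: cvg_fst.
    exact: cvg_snd.
  exact: coord_continuous.
have de_ i : differentiable (fun y : V => y.2 i 0 : R) z.
  apply: differentiable_linear => [k x y|x]; first by rewrite !mxE.
  apply: (@continuous_comp _ _ _ (fun y : V => y.2) (fun u => u i 0)).
    exact: cvg_snd.
  exact: coord_continuous.
rewrite (_ : saddle_form _ _ _ _ _ _ = fun y : V =>
  2^-1 * dotc y.1.1 (B1 *m y.1.1) + dotc y.1.1 b1
  + 2^-1 * dotc y.1.2 (B2 *m y.1.2) + dotc y.1.2 b2
  + 2^-1 * dotc y.2 (B3 *m y.2) + dotc y.2 b1
  + dotc y.1.1 (C *m y.1.2) + dotc y.1.1 (B1 *m y.2) + dotc y.2 (C *m y.1.2));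
  last by apply/funext => -[[u g] e].
have dD (f g : V -> R) : differentiable f z -> differentiable g z ->
    differentiable (fun y => f y + g y) z by exact: differentiableD.
have dZ k (f : V -> R) : differentiable f z ->
    differentiable (fun y => k * f y) z by exact: differentiableZ.
have dcst n (a : 'cV[R]_n) i : differentiable (fun=> a i 0 : R) z.
  exact: differentiable_cst.
by do ?apply: (dD); do ?apply: (dZ); apply: differentiable_dotc => // i;
  exact: differentiable_mulmx.
Qed.

Hypotheses (B1_pd : posdef B1) (B13_pd : posdef (B1 - B3))
  (block_pd : posdef (- block_mx B2 C^T C B3)).

(** By the exact expansion, the difference quotient at [t != 0] along [h] is [L + t * H], which
    tends to [L]. *)
Lemma diff_saddle_form (z h : V) :
  'd (saddle_form B1 B3 B2 C b1 b2 : V -> R^o) z h = saddle_grad B1 B3 B2 C b1 b2 z h.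
Proof.
rewrite -deriveE; last exact: differentiable_saddle_form.
apply/cvg_lim => //.
set L := saddle_grad _ _ _ _ _ _ z h.
pose H := saddle_hess B1 B3 B2 C h.
have : (fun t : R => L + t * H) @ 0^' --> L + 0 * H.
  apply: cvgD; first exact: cvg_cst.
  by apply: cvgM; [exact: cvg_within|exact: cvg_cst].
rewrite mul0r addr0; apply: cvg_trans; apply: near_eq_cvg.
near=> t.
have t0 : t != 0 by near: t; exact: nbhs_dnbhs_neq.
have gradZ : saddle_grad B1 B3 B2 C b1 b2 z (t *: h) = t * L.
  by rewrite /L /saddle_grad/= !dotcZl -!mulrDr.
have hessZ : saddle_hess B1 B3 B2 C (t *: h) = t * (t * H).
  by rewrite /H /saddle_hess/= -!scalemxAr !dotcZl !dotcZr; ring.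
have shiftE : (saddle_form B1 B3 B2 C b1 b2 \o shift z) (t *: h)
    = saddle_form B1 B3 B2 C b1 b2 z + t * L + t * (t * H).
  by rewrite -gradZ -hessZ -saddle_form_add// (addrC z).
by rewrite shiftE /GRing.scale/=; field.
Unshelve. all: by end_near. Qed.

Lemma stationary_saddle_form (z : V) :
  stationary (saddle_form B1 B3 B2 C b1 b2 : V -> R^o) z <->
  z = (saddle_u B1 B2 C b1 b2, saddle_g B1 B2 C b1 b2, 0).
Proof.
rewrite -(saddle_grad_eq0 _ _ B1_pd B13_pd block_pd); split=> [[_ dz] h|gz].
  by rewrite -diff_saddle_form dz.
split; first exact: differentiable_saddle_form.
by move=> h; rewrite diff_saddle_form gz.
Qed.

End SaddleStationary.

(** * One stage: the objective and its optimal value *)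

Section Stage.
Context {R : realType} {dx du : nat} (D : lq_data R dx du).
Variables (t : nat) (P : 'M[R]_dx) (p : 'cV[R]_dx) (r : R).
Hypotheses (P_sym : P^T = P) (N_sym : (lq_N D t)^T = lq_N D t)
  (Xi_pd : posdef (lq_Xi D t)) (condA : conditionA D t P).

Let S : 'M[R]_dx := lq_B D *m lq_Xi D t *m (lq_B D)^T + lq_Lam D t.

(** The value of the stage objective at zero controls; [k] is then the mean of the next state. *)
Definition stage_const (x : 'cV[R]_dx) : R :=
  let k := lq_a D + lq_A D *m x in
  theta D * (dotc x (lq_M D *m x) + \tr (lq_Xi D t *m lq_N D t) + dotc x (lq_m D))
  + 2^-1 * dotc k (P *m k) + dotc k p + 2^-1 * \tr (S *m P) + r.

(** Regroups around [a + A x], which [stage_objectiveE] then treats as a single atom. *)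
Lemma frak1_affineE x : frakA1 D P *m x + fraka1 D P p =
  (lq_B D)^T *m (P *m (lq_a D + lq_A D *m x)) + (lq_B D)^T *m p
  + theta D *: (lq_Q D *m x) + theta D *: lq_n D.
Proof.
rewrite /frakA1 /fraka1 mulmxDl !mulmxDr -!mulmxA -scalemxAl.
move: ((lq_B D)^T *m _) ((lq_B D)^T *m _) ((lq_B D)^T *m _) => X Y Z.
by apply/colP => i; rewrite !mxE; ring.
Qed.

Lemma frak2_affineE x : frakA2 D P *m x + fraka2 D P p =
  P *m (lq_a D + lq_A D *m x) + p.
Proof.
by rewrite /frakA2 /fraka2 P_sym mulmxDr -mulmxA addrA (addrC (P *m _)).
Qed.

Lemma stage_objectiveE x u g e :
  let y := next_state D x u g e in
  running_cost D t x u g e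
    + (2^-1 * dotc y (P *m y) + dotc y p + r + 2^-1 * \tr (S *m P))
  = stage_F D t P p x (u, g, e) + stage_const x.
Proof.
rewrite /= /stage_F /running_cost /stage_const frak1_affineE frak2_affineE.
rewrite /next_state; move: (lq_a D + lq_A D *m x) (\tr (S *m P)) => k tSP.
rewrite /frakB3 /frakB2 /frakB1 /frakC.
rewrite !mulmxDr !mulmxDl !mulNmx -!mulmxA -!scalemxAl !dotcDr !dotcDl !dotcNr.
rewrite !dotcZr.
rewrite !(dotc_mulmx ((lq_B D)^T)) !trmxK.
set Bu := lq_B D *m u; set Be := lq_B D *m e.
(* Each symmetric bilinear form is oriented the same way on both sides, leaving a polynomial
   identity in scalars. *)
rewrite (dotc_sym P k Bu)// (dotc_sym P k Be)// (dotc_sym P k g)//.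
rewrite (dotc_sym P Be Bu)// (dotc_sym P g Bu)// (dotc_sym P g Be)//.
rewrite (dotc_sym (lq_N D t) e u)//.
by field.
Qed.

Lemma frakB13_pd : posdef (frakB1 D t P - frakB3 D t P).
Proof. by rewrite /frakB3 opprD addrCA subrr addr0 opprK; exact: posdef_invmx. Qed.

(** The vectors [b1] and [b2] are affine in [x], so the critical value splits by degree in [x] into
    the three recursions. Taking [sympart] leaves the quadratic form unchanged. *)
Lemma stage_valueE x :
  saddle_form (frakB1 D t P) (frakB3 D t P) (frakB2 D t P) (frakC D P)
    (frakA1 D P *m x + fraka1 D P p) (frakA2 D P *m x + fraka2 D P p)
    (saddle_u (frakB1 D t P) (frakB2 D t P) (frakC D P)
       (frakA1 D P *m x + fraka1 D P p) (frakA2 D P *m x + fraka2 D P p),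
     saddle_g (frakB1 D t P) (frakB2 D t P) (frakC D P)
       (frakA1 D P *m x + fraka1 D P p) (frakA2 D P *m x + fraka2 D P p), 0)
  + stage_const x
  = 2^-1 * dotc x (sympart (recP D t P) *m x) + dotc x (recp D t P p)
    + recr D t P p r.
Proof.
rewrite (saddle_form_critical _ _ condA.1 frakB13_pd condA.2).
have sympartE (W : 'M[R]_dx) : dotc x (sympart W *m x) = dotc x (W *m x).
  rewrite /sympart -scalemxAl dotcZr mulmxDl dotcDr (dotc_mulmx (W^T)) trmxK.
  by rewrite (dotcC (W *m x)); field.
rewrite sympartE.
rewrite -[saddle_G _ _ _]/(frakG D t P).
have I_sym : (invmx (frakB1 D t P))^T = invmx (frakB1 D t P).
  by rewrite trmx_inv condA.1.1.
have J_sym : (invmx (frakG D t P))^T = invmx (frakG D t P).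
  rewrite trmx_inv; congr invmx.
  by have [] := saddle_G_pd condA.1 condA.2.
rewrite /recP /recp /recr /stage_const /S.
move: (invmx (frakB1 D t P)) (invmx (frakG D t P)) I_sym J_sym => I J I_sym J_sym.
move: (frakA1 D P) (fraka1 D P p) (frakA2 D P) (fraka2 D P p) (frakC D P).
move=> A1 a1 A2 a2 C.
rewrite !mulmxDl !mulNmx -!scalemxAl mulmxDl -!scalemxAl -!mulmxA.
rewrite !dotcDr !dotcNr !dotcZr !dotcDr !dotcZr.
rewrite !(dotc_mulmx (A1^T)) !(dotc_mulmx (A2^T)) !(dotc_mulmx ((lq_A D)^T)) !trmxK.
(* Carrying [C] and the inverse of [frakB1] to the left argument reduces every term in [J] to a
   [J]-product of the vectors [be], [a2], [ga], [c]. *)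
have moveC z y : dotc z (I *m (C *m y)) = dotc (C^T *m (I *m z)) y.
  by rewrite (dotc_mulmx I) I_sym dotc_mulmx.
rewrite !moveC raddfD/=.
move: (A1 *m x) (A2 *m x) (lq_A D *m x) => al be ka.
rewrite !(mulmxDr, mulmxN, dotcDl, dotcDr, dotcNl, dotcNr, opprD).
move: (C^T *m (I *m al)) (C^T *m (I *m a1)) => ga c.
rewrite (dotc_sym I a1 al)// (dotc_sym P (lq_a D) ka)//.
rewrite (dotc_sym J be ga)// (dotc_sym J a2 ga)// (dotc_sym J c ga)// (dotc_sym J c be)//.
rewrite (dotc_sym J a2 be)// (dotc_sym J a2 c)//.
by field.
Qed.

End Stage.

(** * The Bellman operator on quadratic functions *)

Section BellmanStep.
Context {R : realType} {dx du : nat} (D : lq_data R dx du).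
Context {disp : measure_display} {Om : measurableType disp}.
Variables (Pr : nat -> 'cV[R]_dx -> 'cV[R]_du -> probability Om R)
  (w : nat -> Om -> 'cV[R]_dx) (v : nat -> Om -> 'cV[R]_du).

Lemma bellman_quadratic T t P p r :
    (t < T)%N -> gaussian_noise D Pr w v T ->
    possemidef (lq_N D t) -> posdef (lq_Lam D t) -> posdef (lq_Xi D t) ->
    P^T = P -> conditionA D t P -> forall x,
  bellman D Pr w v t (fun y => (2^-1 * dotc y (P *m y) + dotc y p + r)%:E) x
  = (2^-1 * dotc x (sympart (recP D t P) *m x) + dotc x (recp D t P p)
     + recr D t P p r)%:E.
Proof.
move=> tT noise N_psd Lam_pd Xi_pd P_sym condA x.
have B13_pd := frakB13_pd P Xi_pd.
(* The right-hand side is expanded back into an inf sup, so that it suffices to compare objectives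
   for each [u] and [(g, e)]. *)
rewrite -(stage_valueE p r P_sym Xi_pd condA).
rewrite -(saddle_value _ _ condA.1 B13_pd condA.2).
apply: (congr1 (fun f => ereal_inf (range f))); apply/funext => u.
apply: (congr1 (fun f => ereal_sup (range f))); apply/funext => -[g e].
have [gw gv wv] := noise t tT g e.
have [_ ->] := next_state_quadratic_mean P p r Lam_pd Xi_pd gw gv wv x u.
by rewrite -EFinD (stage_objectiveE p r P_sym N_psd.1).
Qed.

End BellmanStep.

(** * The coefficient sequences *)

Section Coefficients.
Context {R : realType} {dx du : nat} (D : lq_data R dx du) (T : nat).

Lemma coefsE t : (t < T)%N -> coefs D T t =
  (sympart (recP D t (coefP D T t.+1)),
   recp D t (coefP D T t.+1) (coefp D T t.+1),
   recr D t (coefP D T t.+1) (coefp D T t.+1) (coefr D T t.+1)).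
Proof.
move=> tT; rewrite /coefP /coefp /coefr /coefs backwardE//.
by case: (backward _ _ _ _) => [[P p] r].
Qed.

Lemma tr_sympart (S : 'M[R]_dx) : (sympart S)^T = sympart S.
Proof. by rewrite /sympart linearZ/= linearD/= trmxK addrC. Qed.

Lemma coefP_sym t : (lq_MT D)^T = lq_MT D -> (t <= T)%N ->
  (coefP D T t)^T = coefP D T t.
Proof.
move=> MT_sym; rewrite leq_eqVlt => /predU1P[->|tT].
  by rewrite /coefP /coefs backwardT/= linearZ/= MT_sym.
by rewrite /coefP coefsE// tr_sympart.
Qed.

End Coefficients.

Theorem theorem3p5 (R : realType) (T dx du : nat) (D : lq_data R dx du)
    (disp : measure_display) (Om : measurableType disp)
    (Pr : nat -> 'cV[R]_dx -> 'cV[R]_du -> probability Om R)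
    (w : nat -> Om -> 'cV[R]_dx) (v : nat -> Om -> 'cV[R]_du)
    (T_ge1 : (1 <= T)%N)
    (theta_range : -1 < theta D < 0 \/ 0 < theta D)
    (M_psd : possemidef (lq_M D))
    (MT_sym : (lq_MT D)^T = lq_MT D)
    (N_psd : forall t, (t < T)%N -> possemidef (lq_N D t))
    (Lam_pd : forall t, (t < T)%N -> posdef (lq_Lam D t))
    (Xi_pd : forall t, (t < T)%N -> posdef (lq_Xi D t))
    (noise : gaussian_noise D Pr w v T)
    (condA : forall t, (t < T)%N -> conditionA D t (coefP D T t.+1)) :
  let P := coefP D T in
  let p := coefp D T in
  let r := coefr D T in
  [/\ forall t, (t <= T)%N -> forall x : 'cV[R]_dx,
        value D Pr w v T t x
        = (2^-1 * dotc x (P t *m x) + dotc x (p t) + r t)%:E,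
      [/\ P T = 2 * theta D *: lq_MT D,
          forall t, (t <= T)%N -> (P t)^T = P t
        & forall t, (t < T)%N -> P t = sympart (recP D t (P t.+1))],
      p T = theta D *: lq_mT D /\
      (forall t, (t < T)%N -> p t = recp D t (P t.+1) (p t.+1)),
      r T = 0 /\
      (forall t, (t < T)%N -> r t = recr D t (P t.+1) (p t.+1) (r t.+1))
    & forall t, (t < T)%N -> forall x : 'cV[R]_dx,
        exists (us : 'cV[R]_du) (gs : 'cV[R]_dx) (es : 'cV[R]_du),
        [/\ forall z, stationary (stage_F D t (P t.+1) (p t.+1) x) z
                      <-> z = (us, gs, es),
            us = - (invmx (frakB1 D t (P t.+1))
                    *m (frakA1 D (P t.+1) *m x + fraka1 D (P t.+1) (p t.+1)
                        + frakC D (P t.+1) *m gs)) - es,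
            gs = - (invmx (frakB2 D t (P t.+1))
                    *m (frakA2 D (P t.+1) *m x + fraka2 D (P t.+1) (p t.+1)
                        + (frakC D (P t.+1))^T *m (us + es)))
          & es = 0]].
Proof.
move=> P p r.
have P_sym t : (t <= T)%N -> (P t)^T = P t by exact: coefP_sym.
split.
(* Induction on the number [T - t] of remaining stages. *)
- move=> t; elim: {t}(T - t)%N {-2}t (erefl (T - t)%N) => [|k IH] t.
    move=> /eqP; rewrite subn_eq0 => Tt tT x.
    have -> : t = T by apply/eqP; rewrite eqn_leq tT.
    rewrite /value backwardT /P /p /r /coefP /coefp /coefr /coefs backwardT/=.
    rewrite /terminal_value -scalemxAl !dotcZr addr0; congr (_%:E).
    by field.
  move=> Tt _ x; have tT : (t < T)%N by rewrite -subn_gt0 Tt.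
  rewrite /value backwardE// -/(value D Pr w v T t.+1).
  (* The Bellman operator integrates the whole next value function, so the induction hypothesis is
     used as an equality of functions. *)
  have -> : value D Pr w v T t.+1 = fun y =>
      (2^-1 * dotc y (P t.+1 *m y) + dotc y (p t.+1) + r t.+1)%:E.
    by apply/funext => y; apply: IH => //; rewrite subnS Tt.
  rewrite (bellman_quadratic (p t.+1) (r t.+1) tT noise (N_psd t tT) (Lam_pd t tT)
             (Xi_pd t tT) (P_sym _ tT) (condA t tT)).
  by rewrite /P /p /r [in RHS]/coefP [in RHS]/coefp [in RHS]/coefr coefsE.
- split=> //; first by rewrite /P /coefP /coefs backwardT.
  by move=> t tT; rewrite /P [in LHS]/coefP coefsE.
- split=> [|t tT]; first by rewrite /p /coefp /coefs backwardT.
  by rewrite /p [in LHS]/coefp coefsE.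
- split=> [|t tT]; first by rewrite /r /coefr /coefs backwardT.
  by rewrite /r [in LHS]/coefr coefsE.
- move=> t tT x; have [B1_pd block_pd] := condA t tT.
  have B13_pd := frakB13_pd (P t.+1) (Xi_pd t tT).
  set b1 := frakA1 D (P t.+1) *m x + fraka1 D (P t.+1) (p t.+1).
  set b2 := frakA2 D (P t.+1) *m x + fraka2 D (P t.+1) (p t.+1).
  pose us := saddle_u (frakB1 D t (P t.+1)) (frakB2 D t (P t.+1))
    (frakC D (P t.+1)) b1 b2.
  pose gs := saddle_g (frakB1 D t (P t.+1)) (frakB2 D t (P t.+1))
    (frakC D (P t.+1)) b1 b2.
  exists us, gs, 0; split=> //.
  + exact: stationary_saddle_form B1_pd B13_pd block_pd.
  + by rewrite subr0.
  + by rewrite addr0; exact: saddle_gE B1_pd B13_pd block_pd.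
Qed.
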